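(* Let $m\in\mathbb N$ and let $\nu$ be a Borel measure on $H$ belonging to the class $\mathfrak F(m,H)$ and invariant under the action of $U(\infty)$ on $H$ by conjugation. If $\nu$ is ergodic, then $\nu$ is finite, i.e. $\nu(H)<+\infty$.
   Context: $H=\{h=(h_{ij})_{i,j\in\mathbb N}: h_{ij}\in\mathbb C,\ h_{ij}=\overline{h_{ji}}\}$ is the space of infinite Hermitian matrices (with the topology of entrywise convergence and its Borel $\sigma$-algebra). $U(\infty)$ is the infinite unitary group: an infinite matrix $u=(u_{ij})_{i,j\in\mathbb N}$ belongs to $U(\infty)$ if there is $n_0\in\mathbb N$ such that $(u_{ij})_{1\le i,j\le n_0}$ is unitary, $u_{ii}=1$ for $i>n_0$, and $u_{ij}=0$ whenever $i\ne j$ and $\max(i,j)>n_0$. The group $U(\infty)$ acts on $H$ by conjugation, $h\mapsto uhu^{-1}$. Measures may be finite or infinite. A $U(\infty)$-invariant measure is ergodic if every $U(\infty)$-invariant Borel set either has measure zero or has complement of measure zero. For $m\in\mathbb N$, $\mathfrak F(m,H)$ is the class of Borel measures $\nu$ on $H$ such that for every $R>0$ one has $\nu(\{h\in H:\max_{i\le m,j\le m}|h_{ij}|\le R\})<\infty$. *)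

(* Defs.v *)
From HB Require Import structures.
From mathcomp Require Import all_boot all_order all_algebra.
From mathcomp Require Import spectral complex.
From mathcomp Require Import all_classical all_reals all_analysis.
Set Implicit Arguments.
Unset Strict Implicit.
Unset Printing Implicit Defensive.
Import Order.TTheory GRing.Theory Num.Theory.
Local Open Scope classical_set_scope.
Local Open Scope ring_scope.
Local Open Scope complex_scope.

(* Indices run over [nat], so that the corner
   1 <= i, j <= n is the set of indices i, j < n. *)

Notation infmx R := (nat -> nat -> R[i]).

(* The sum is a finite-support sum: it is 0 when infinitely many terms are
   nonzero, which never happens below because rows and columns of elements of
   U(oo) are finitely supported. *)
Definition infmx_mul (R : realType) (a b : infmx R) : infmx R :=
  fun i j => \sum_(k \in [set: nat]) a i k * b k j.

Definition infmx1 (R : realType) : infmx R := fun i j => (i == j)%:R.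

Definition infmx_adj (R : realType) (a : infmx R) : infmx R :=
  fun i j => (a j i)^*%R.

Definition infmx_hermitian (R : realType) (h : infmx R) :=
  forall i j, h i j = (h j i)^*%R.

Definition in_Uinf (R : realType) (u : infmx R) :=
  exists n0 : nat,
    [/\ (\matrix_(i < n0, j < n0) u i j) \is unitarymx,
        forall i, (n0 <= i)%N -> u i i = 1 &
        forall i j, i != j -> (n0 <= maxn i j)%N -> u i j = 0].

Record Uinf (R : realType) := MkUinf {
  Uinf_val :> infmx R;
  Uinf_valP : in_Uinf Uinf_val }.

Record infherm (R : realType) := MkInfherm {
  infherm_val :> infmx R;
  infherm_valP : infmx_hermitian infherm_val }.

Lemma infherm_inj (R : realType) : injective (@infherm_val R).
Proof.
by move=> [a Ha] [b Hb] /= ab; subst b; rewrite (Prop_irrelevance Ha Hb).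
Qed.

Lemma infherm0_subproof (R : realType) :
  infmx_hermitian ((fun _ _ => 0) : infmx R).
Proof. by move=> i j; rewrite rmorph0. Qed.

Definition infherm0 (R : realType) : infherm R :=
  MkInfherm (@infherm0_subproof R).

(* Topology of entrywise convergence: the one induced by the product topology
   on nat -> nat -> C, where C carries its norm topology ([R[i]^o]). *)
Definition infherm_entries (R : realType) (h : infherm R) :
  {ptws nat -> {ptws nat -> R[i]^o}} := infherm_val h.

HB.instance Definition _ (R : realType) := gen_eqMixin (infherm R).
HB.instance Definition _ (R : realType) := gen_choiceMixin (infherm R).
HB.instance Definition _ (R : realType) :=
  isPointed.Build (infherm R) (infherm0 R).
HB.instance Definition _ (R : realType) :=
  Topological.copy (infherm R) (initial_topology (@infherm_entries R)).

(* Borel sigma-algebra *)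
HB.instance Definition _ (R : realType) :=
  Measurable.copy (infherm R)
    (g_sigma_algebraType (@open (infherm R))).

Lemma infherm_measurableE (R : realType) :
  @measurable _ (infherm R) = <<s @open (infherm R) >>.
Proof. by []. Qed.

Lemma infmx_mulE (R : realType) (N : nat) (a b : infmx R) i j :
  (forall k, (N <= k)%N -> a i k * b k j = 0) ->
  infmx_mul a b i j = \sum_(k < N) a i k * b k j.
Proof.
move=> H; rewrite /infmx_mul (fsbig_ord _ _ (fun k => a i k * b k j)).
apply/esym/fsbig_widen => //= k [_ /= /negP].
by rewrite -leqNgt => /H.
Qed.

Lemma Uinf_supp (R : realType) (u : Uinf R) :
  exists n0, forall N, (n0 <= N)%N -> forall i k, (i < N)%N -> (N <= k)%N ->
    u i k = 0 /\ u k i = 0.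
Proof.
have [n0 [_ _ H]] := Uinf_valP u; exists n0 => N n0N i k iN Nk.
have ik : i != k by rewrite neq_ltn (leq_trans iN Nk).
split; apply: H; do ?by rewrite leq_max (leq_trans n0N Nk) ?orbT.
- by [].
- by rewrite eq_sym.
Qed.

Lemma in_Uinf_adj (R : realType) (u : Uinf R) : in_Uinf (infmx_adj u).
Proof.
have [n0 [uu u1 u0]] := Uinf_valP u; exists n0; split.
- rewrite (_ : \matrix_(i, j) _ =
    map_mx Num.conj (\matrix_(i < n0, j < n0) u i j)^T).
    by rewrite trmxC_unitary.
  by apply/matrixP => i j; rewrite !mxE.
- by move=> i /u1 ui; rewrite /infmx_adj ui rmorph1.
- move=> i j ij n0ij; rewrite /infmx_adj u0 ?rmorph0 //.
    by rewrite eq_sym.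
  by rewrite maxnC.
Qed.

Definition Uinf_inv (R : realType) (u : Uinf R) : Uinf R :=
  MkUinf (in_Uinf_adj u).

Lemma Uinf_mulV (R : realType) (u : Uinf R) :
  infmx_mul u (Uinf_inv u) = infmx1 R.
Proof.
apply/funext => i; apply/funext => j.
have [n0 [uu u1 u0]] := Uinf_valP u.
have uE k l : (n0 <= maxn k l)%N -> u k l = (k == l)%:R.
  case: (eqVneq k l) => [->|kl]; last exact: u0.
  by rewrite maxnn; apply: u1.
have sgl k (c : nat -> R[i]) : (forall l, l != k -> c l = 0) ->
    \sum_(l < (maxn n0 k).+1) c l = c k.
  move=> ck; have kN : (k < (maxn n0 k).+1)%N by rewrite ltnS leq_maxr.
  rewrite (bigD1 (Ordinal kN)) //= big1 ?addr0 // => l lk; exact: ck.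
have [/andP[i0 j0]|] := boolP ((i < n0) && (j < n0))%N.
  rewrite (@infmx_mulE _ n0); last first.
    move=> k n0k; rewrite uE ?leq_max ?n0k ?orbT //.
    by rewrite (_ : i == k = false) ?mul0r // ltn_eqF // (leq_trans i0).
  move/unitarymxP : uu => /matrixP /(_ (Ordinal i0) (Ordinal j0)).
  rewrite !mxE /= => E; rewrite /infmx1 -[(_ == _)%:R]E.
  by apply: eq_bigr => k _; rewrite !mxE.
rewrite negb_and -!leqNgt => /orP[n0i|n0j].
- rewrite (@infmx_mulE _ (maxn n0 i).+1); last first.
    move=> k; rewrite gtn_max => /andP[_ ik].
    by rewrite uE ?leq_max ?n0i // ltn_eqF ?mul0r.
  rewrite (sgl i (fun k => u i k * (Uinf_inv u) k j)); last first.
    by move=> l li; rewrite uE ?leq_max ?n0i // eq_sym (negbTE li) mul0r.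
  rewrite uE ?leq_max ?n0i // eqxx mul1r /= /infmx_adj uE ?leq_max ?n0i ?orbT //.
  by rewrite rmorph_nat eq_sym.
- rewrite (@infmx_mulE _ (maxn n0 j).+1); last first.
    move=> k; rewrite gtn_max => /andP[_ jk].
    by rewrite /= /infmx_adj (uE j) ?leq_max ?n0j // ltn_eqF // rmorph0 mulr0.
  rewrite (sgl j (fun k => u i k * (Uinf_inv u) k j)); last first.
    move=> l lj; rewrite /= /infmx_adj (uE j) ?leq_max ?n0j //.
    by rewrite eq_sym (negbTE lj) rmorph0 mulr0.
  rewrite /= /infmx_adj !uE ?leq_max ?n0j ?orbT //.
  by rewrite eqxx rmorph1 mulr1.
Qed.

Lemma Uinf_mulKV (R : realType) (u : Uinf R) :
  infmx_mul (Uinf_inv u) u = infmx1 R.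
Proof.
rewrite -(Uinf_mulV (Uinf_inv u)); congr infmx_mul.
apply/funext => i; apply/funext => j; rewrite /= /infmx_adj. 
exact/esym/conjCK.
Qed.

Lemma Uinf_act_hermitian (R : realType) (u : Uinf R) (h : infherm R) :
  infmx_hermitian (infmx_mul (infmx_mul u h) (Uinf_inv u)).
Proof.
have [n0 H] := Uinf_supp u.
have conjK (z : R[i]) : z^*%R^*%R = z by exact: conjCK.
suff E i j N : (n0 <= N)%N -> (i < N)%N -> (j < N)%N ->
    infmx_mul (infmx_mul u h) (Uinf_inv u) i j =
    \sum_(l < N) \sum_(k < N) u i k * h k l * (u j l)^*%R.
  move=> i j; pose N := maxn n0 (maxn i.+1 j.+1).
  have n0N : (n0 <= N)%N by rewrite leq_maxl.
  have iN : (i < N)%N by rewrite !leq_max leqnn orbT.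
  have jN : (j < N)%N by rewrite !leq_max leqnn !orbT.
  rewrite !(E _ _ N) // rmorph_sum exchange_big /=; apply: eq_bigr => k _.
  rewrite rmorph_sum; apply: eq_bigr => l _.
  by rewrite !rmorphM /= conjK -(infherm_valP h) [LHS]mulrC [X in _ * X = _]mulrC mulrA.
move=> n0N iN jN; rewrite (@infmx_mulE _ N); last first.
  by move=> k Nk; rewrite /= /infmx_adj (H N n0N j k jN Nk).1 rmorph0 mulr0.
apply: eq_bigr => l _; rewrite (@infmx_mulE _ N) ?mulr_suml //.
by move=> k Nk; rewrite (H N n0N i k iN Nk).1 mul0r.
Qed.

Definition Uinf_act (R : realType) (u : Uinf R) (h : infherm R) : infherm R :=
  MkInfherm (@Uinf_act_hermitian R u h).

Definition Uinf_invariant_measure (R : realType)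
    (nu : {measure set (infherm R) -> \bar R}) :=
  forall (u : Uinf R) (A : set (infherm R)), measurable A ->
    nu (Uinf_act u @^-1` A) = nu A.

Definition Uinf_invariant_set (R : realType) (A : set (infherm R)) :=
  forall u : Uinf R, Uinf_act u @` A = A.

Definition Uinf_ergodic (R : realType)
    (nu : {measure set (infherm R) -> \bar R}) :=
  forall A : set (infherm R), measurable A -> Uinf_invariant_set A ->
    nu A = 0%E \/ nu (~` A) = 0%E.

(* [Normc.normc z : R] is the modulus of z. *)
Definition corner_norm (R : realType) (m : nat) (h : infherm R) : R :=
  \big[Num.max/0]_(i < m) \big[Num.max/0]_(j < m) Normc.normc (h i j).

Definition classF (R : realType) (m : nat)
    (nu : {measure set (infherm R) -> \bar R}) :=
  forall r : R, 0 < r -> (nu [set h : infherm R | corner_norm m h <= r]%R < +oo)%E.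

(* Main.v *)
Require Import Defs.
From HB Require Import structures.
From mathcomp Require Import all_boot all_order all_algebra.
Set Implicit Arguments.
Unset Strict Implicit.
Unset Printing Implicit Defensive.

(** Let [A_r] be the set of [h] whose m-corner is bounded by [r].

    Tightness: there are [r], [r'] and [c > 0] such that
    [nu (A_r `&` u^-1 A_r') >= c] for every [u] in U(oo).  Indeed, if [v] fixes the
    first m coordinates then [A_r] is [v]-invariant, so [u] may be replaced by
    [u v]; Gram-Schmidt provides a [v] such that the first m rows of [u v] are
    supported on the first 2m columns, and then the m-corner of [(u v) h (u v)^*]
    is bounded on the set of [h] with bounded 2m-corner.

    Averaging: let [f] be a Lipschitz cutoff with [1_{A_r'} <= f <= 1_{A_(r'+1)}].
    In place of the Haar average of [f] over U(n) we take the average over a finite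
    net of minimal cardinality.  By Hall's marriage theorem, translating such a net
    amounts to permuting it and moving each point by at most twice the mesh, so the
    average [F_n], cut off to the U(n)-invariant set where the Frobenius norm of
    the n-corner is at most a large constant, is uniformly almost U(n)-invariant,
    while [\int F_n <= nu A_(r'+1)] and [\int_{A_r} F_n >= c / 2].

    Limit: almost norm-minimal elements [g_k] of the convex hulls of the tails of
    [F] form a Cauchy sequence in L^2.  Suitable superlevel sets of [limsup g_k] are
    then strictly U(oo)-invariant, of positive measure (Fatou on [A_r]) and of
    finite measure (Chebyshev).  By ergodicity such a set is conull, so [nu] is
    finite. *)

(** * Hall's marriage theorem *)

Section Hall.
Variables (S T : finType) (e : S -> T -> bool) (y0 : T).
Implicit Types (A X Y : {set S}) (B : {set T}).

Let nbr B X := [set y in B | [exists x in X, e x y]].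

Let nbrP B X y : reflect (y \in B /\ exists2 x, x \in X & e x y) (y \in nbr B X).
Proof.
rewrite inE; apply: (iffP andP) => -[-> H]; split=> //.
  by have [x /andP[? ?]] := existsP H; exists x.
by have [x xX exy] := H; apply/existsP; exists x; rewrite xX.
Qed.

(** Induction on [#|A|], after Halmos and Vaughan. If some nonempty proper subset [X] of [A] is
    tight, [X] is matched into its own neighbours and [A :\: X] into the rest of [B]. Otherwise
    every such subset has a neighbour to spare, and any single point can be matched first. *)
Lemma hall_in A B :
  (forall X, X \subset A -> #|X| <= #|nbr B X|) ->
  exists f : S -> T, {in A &, injective f} /\
    (forall x, x \in A -> e x (f x) /\ f x \in B).
Proof.
have [k] := ubnP #|A|; elim: k A B => // k IH A B; rewrite ltnS => Ak hall.
have [->|[a aA]] := set_0Vmem A.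
  by exists (fun=> y0); split=> [x y|x]; rewrite inE.
have [/existsP[X /and4P[X0 XA XnA XN]]|noX] :=
  boolP [exists X : {set S}, [&& X != set0, X \subset A, X != A & #|nbr B X| <= #|X|]].
- have XltA : #|X| < #|A| by rewrite proper_card // properEneq XnA.
  have [|f [finj fe]] := IH X B (leq_trans XltA Ak).
    by move=> Y YX; apply: hall; apply: subset_trans YX XA.
  have [||g [ginj ge]] := IH (A :\: X) (B :\: nbr B X).
  + rewrite cardsD (setIidPr XA); apply: leq_trans Ak.
    by rewrite ltn_subrL (leq_trans _ XltA) // andbT lt0n cards_eq0.
  + move=> Y; rewrite subsetD => /andP[YA YX].
    have XY : [disjoint X & Y] by rewrite disjoint_sym.
    have /hall : X :|: Y \subset A by rewrite subUset XA.
    rewrite cardsU (_ : X :&: Y = set0) ?cards0 ?subn0; last first.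
      by apply/eqP; rewrite setI_eq0.
    (* A neighbour of [X :|: Y] outside [nbr B X] comes from [Y]; since [X] is tight, Hall's
       condition for [X :|: Y] passes to [Y]. *)
    have -> : nbr B (X :|: Y) = nbr B X :|: nbr (B :\: nbr B X) Y.
      apply/setP => y; rewrite in_setU; apply/nbrP/orP.
        move=> [yB [x]]; rewrite inE => /orP[xX|xY] exy.
          by left; apply/nbrP; split=> //; exists x.
        have [?|yX] := boolP (y \in nbr B X); [by left|right].
        by apply/nbrP; split; [rewrite inE yX|exists x].
      case=> /nbrP[].
        by move=> yB [x xX exy]; split=> //; exists x; rewrite // inE xX.
      by rewrite inE => /andP[_ yB] [x xY exy]; split=> //; exists x;
        rewrite // inE xY orbT.
    by move=> /leq_trans/(_ (leq_card_setU _ _)) le; rewrite -(leq_add2l #|X|);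
       apply: leq_trans le _; rewrite leq_add2r.
  exists (fun x => if x \in X then f x else g x).
  have fN x : x \in X -> f x \in nbr B X.
    by move=> xX; have [exf fB] := fe x xX; apply/nbrP; split=> //; exists x.
  have gN x : x \in A -> x \notin X -> g x \notin nbr B X.
    by move=> xA xX; have [|_] := ge x; rewrite ?inE ?xA ?xX // => /andP[].
  split=> [x y xA yA|x xA].
    case: ifPn => xX; case: ifPn => yX.
    * exact: finj.
    * by move=> E; case/negP: (gN _ yA yX); rewrite -E fN.
    * by move=> E; case/negP: (gN _ xA xX); rewrite E fN.
    * by apply: ginj; rewrite inE ?xX ?yX.
  case: ifPn => xX; first exact: fe.
  by have [|? ] := ge x; rewrite ?inE ?xX // => /andP[_ ?].
- have /hall : [set a] \subset A by rewrite sub1set.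
  rewrite cards1 => /card_gt0P[y /nbrP[yB [_ /set1P-> eay]]].
  have [||f [finj fe]] := IH (A :\ a) (B :\ y).
  + by apply: leq_trans Ak; rewrite [X in _ < X](cardsD1 a) aA.
  + move=> Y YA; have [->|Y0] := eqVneq Y set0; first by rewrite cards0.
    have YsA : Y \subset A by apply: subset_trans YA (subsetDl _ _).
    have aY : a \notin Y by apply/negP => /(subsetP YA); rewrite !inE eqxx.
    have YnA : Y != A by apply: contraNneq aY => ->.
    have := noX; rewrite negb_exists => /forallP/(_ Y).
    (* [Y] is not tight: it has at least [#|Y| + 1] neighbours and can afford to lose [y]. *)
    rewrite Y0 YsA YnA /= -ltnNge => lt; rewrite -ltnS.
    apply: leq_trans lt _.
    have -> : nbr (B :\ y) Y = nbr B Y :\ y.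
      by apply/setP => z; rewrite !inE andbA.
    by rewrite (cardsD1 y (nbr B Y)); case: (_ \in _).
  exists (fun x => if x == a then y else f x); split=> [x z xA zA|x xA].
    case: eqVneq => [->|xa]; case: eqVneq => [->|za] //.
    * by move=> E; have [|_] := fe z; rewrite !inE ?za ?zA // -E eqxx.
    * by move=> E; have [|_] := fe x; rewrite !inE ?xa ?xA // E eqxx.
    * by apply: finj; rewrite !inE ?xa ?za.
  case: eqVneq => [->|xa]; first by [].
  by have [|? ] := fe x; rewrite !inE ?xa ?xA // => /andP[_ ?].
Qed.

End Hall.

Lemma hall_marriage (S T : finType) (e : S -> T -> bool) (y0 : T) :
  (forall X : {set S}, #|X| <= #|[set y | [exists x in X, e x y]]|) ->
  exists2 f : S -> T, injective f & forall x, e x (f x).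
Proof.
move=> hall; have [|f [finj fe]] := @hall_in S T e y0 setT setT.
  move=> X _; apply: leq_trans (hall X) _; apply: subset_leq_card.
  by apply/subsetP => y; rewrite !inE.
by exists f => [x z /finj->|x]; rewrite ?inE //; have [|] := fe x; rewrite ?inE.
Qed.

From mathcomp Require Import spectral complex zify lra ring.
From mathcomp Require Import all_classical all_reals all_analysis.
From mathcomp Require Import measurable_realfun realfun.
Import Order.TTheory GRing.Theory Num.Theory.
Import Normc numFieldNormedType.Exports.
Local Open Scope classical_set_scope.
Local Open Scope ring_scope.
Local Open Scope sesquilinear_scope.

(** * Balanced nets in the unitary group *)

Section Normc.
Variable R : realType.
Implicit Types x y : R[i].

Lemma normc_sqrtE x : normc x = Num.sqrt (complex.Re x ^+ 2 + complex.Im x ^+ 2).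
Proof. by case: x. Qed.

Lemma normc_ge0 x : 0 <= normc x.
Proof. by rewrite normc_sqrtE sqrtr_ge0. Qed.

Lemma sqr_normc x : normc x ^+ 2 = complex.Re x ^+ 2 + complex.Im x ^+ 2.
Proof. by rewrite normc_sqrtE sqr_sqrtr // addr_ge0 ?sqr_ge0. Qed.

Lemma sqr_normc_conj x : (normc x ^+ 2)%:C%C = x * x^*%R.
Proof.
rewrite sqr_normc; case: x => a b /=.
by congr (_ +i* _)%C; ring.
Qed.

Lemma normc_conj x : normc x^*%R = normc x.
Proof. by case: x => a b /=; rewrite sqrrN. Qed.

Lemma normcB x y : normc (x - y) = normc (y - x).
Proof. by rewrite -(normcN (x - y)) opprB. Qed.

Lemma normc_sum (I : Type) (r : seq I) (P : pred I) (F : I -> R[i]) :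
  normc (\sum_(i <- r | P i) F i) <= \sum_(i <- r | P i) normc (F i).
Proof.
elim/big_ind2 : _ => [|x1 x2 y1 y2 h1 h2|//]; first by rewrite normc0.
by apply: le_trans (le_normcD _ _) _; rewrite lerD.
Qed.

End Normc.

(** * The squared Frobenius norm and its unitary invariance *)

Section Frobenius.
Variable R : realType.

Definition frob2 m n (M : 'M[R[i]]_(m, n)) : R :=
  \sum_i \sum_j normc (M i j) ^+ 2.

Lemma frob2_trace m n (M : 'M[R[i]]_(m, n)) : (frob2 M)%:C%C = \tr (M *m M^t*).
Proof.
rewrite rmorph_sum; apply: eq_bigr => i _; rewrite mxE rmorph_sum.
apply: eq_bigr => j _; rewrite !mxE. exact: sqr_normc_conj.
Qed.

Lemma frob2_mulr_unitary m n (M : 'M[R[i]]_(m, n)) (u : 'M[R[i]]_n) :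
  u \is unitarymx -> frob2 (M *m u) = frob2 M.
Proof.
move=> uU; apply: complexI; rewrite !frob2_trace trmx_mul map_mxM.
by rewrite !mulmxA mulmxtVK.
Qed.

Lemma frob2_mull_unitary m n (M : 'M[R[i]]_(m, n)) (u : 'M[R[i]]_m) :
  u \is unitarymx -> frob2 (u *m M) = frob2 M.
Proof.
move=> uU; apply: complexI; rewrite !frob2_trace trmx_mul map_mxM.
by rewrite mulmxA mxtrace_mulC !mulmxA -[u^t*]mul1mx mulmxKtV ?mul1mx.
Qed.

Lemma sqr_normc_frob2 m n (M : 'M[R[i]]_(m, n)) i j : normc (M i j) ^+ 2 <= frob2 M.
Proof.
rewrite /frob2 (bigD1 i) //= (bigD1 j) //= -addrA lerDl.
by rewrite addr_ge0 // ?sumr_ge0 // => k _; rewrite ?sqr_ge0 // sumr_ge0 // => l _;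
  rewrite sqr_ge0.
Qed.

Lemma normc_unitary m n (u : 'M[R[i]]_(m, n)) i j : u \is unitarymx -> normc (u i j) <= 1.
Proof.
move=> /unitarymxP/matrixP/(_ i i); rewrite !mxE eqxx => E.
have : \sum_k normc (u i k) ^+ 2 = 1.
  apply: complexI; rewrite rmorph_sum -[RHS]E.
  by apply: eq_bigr => k _; rewrite !mxE; exact: sqr_normc_conj.
rewrite (bigD1 j) //= => E1; rewrite -(@expr_le1 _ 2) ?normc_ge0 // -E1 lerDl.
by apply: sumr_ge0 => k _; rewrite sqr_ge0.
Qed.

End Frobenius.

Section UnitaryNet.
Variables (R : realType) (n : nat).
Local Notation M := 'M[R[i]]_n.

Definition unitary_net (d : R) (I : finType) (e : I -> M) :=
  (forall i, e i \is unitarymx) /\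
  forall u : M, u \is unitarymx -> exists i, frob2 (u - e i) <= d.

(** The real and imaginary parts of all entries lie in [-1, 1]. This cube is cut into finitely many
    cells, and one unitary is picked from each cell that contains one. *)
Lemma unitary_net_exists (d : R) : 0 < d ->
  exists (I : finType) (e : I -> M), unitary_net d e.
Proof.
move=> d0.
(* Each of the [n * n] entries will contribute at most [2 / K] to [frob2]. *)
have [K0 dK] : exists K : nat, ((n * n) * 2)%:R <= d * K.+1%:R.
  exists (Num.truncn (((n * n) * 2)%:R / d)); rewrite mulrC -ler_pdivrMr //.
  exact/ltW/truncnS_gt.
pose K := K0.+1; pose N := (2 * K)%N.
pose q (x : R) : 'I_N.+1 := inord (Num.truncn (K%:R * (x + 1))).
have K_gt0 : 0 < K%:R :> R by rewrite ltr0n.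
(* Points with the same index differ by at most [1 / K], and [1 <= K] bounds the square by [1 / K]
   again. *)
have qP x y : `|x| <= 1 -> `|y| <= 1 -> q x = q y -> (x - y) ^+ 2 <= K%:R^-1.
  have H z : `|z| <= 1 -> (q z : nat) = Num.truncn (K%:R * (z + 1)) /\ 0 <= K%:R * (z + 1).
    rewrite ler_norml => /andP[z1 z2].
    have z0 : 0 <= K%:R * (z + 1) by rewrite mulr_ge0 ?ler0n //; lra.
    split=> //; rewrite inordK // truncn_lt_nat // -natr1 natrM.
    rewrite mulrC; apply: (@le_lt_trans _ _ (2 * K%:R)); last by rewrite ltrDl.
    by rewrite ler_pM2r //; lra.
  move=> x1 y1 E; have [qx x0] := H x x1; have [qy y0] := H y y1.
  have := truncn_itv x0; have := truncn_itv y0; rewrite -qx -qy E -natr1.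
  move: (_%:R) => t /andP[ya yb] /andP[xa xb].
  have K1 : 1 <= K%:R :> R by rewrite ler1n.
  rewrite -[K%:R^-1]mulr1 ler_pdivlMl //.
  have xy : `|K%:R * (x - y)| <= 1 by rewrite ler_norml; apply/andP; split; nra.
  have : (K%:R * (x - y)) ^+ 2 <= 1.
    by rewrite -real_normK ?num_real // expr_le1.
  rewrite exprMn => le1; apply: le_trans le1.
  by apply: ler_wpM2r; rewrite ?sqr_ge0 // expr2 ler_peMl ?ler0n.
pose T := {ffun 'I_n * 'I_n -> 'I_N.+1 * 'I_N.+1}.
pose cell (u : M) : T := [ffun ij => (q (complex.Re (u ij.1 ij.2)), q (complex.Im (u ij.1 ij.2)))].
have rep (t : T) : {e : M | e \is unitarymx &
    forall u, u \is unitarymx -> cell u = t -> cell e = t}.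
  have [/cid[v [vU vt]]|no] := pselect (exists u, u \is unitarymx /\ cell u = t).
    by exists v.
  (* Default representative for a cell that contains no unitary. *)
  exists 1%:M; first by apply/unitarymxP; rewrite trmx1 map_mx1 mulmx1.
  by move=> u uU ut; case: no; exists u.
exists T, (fun t => s2val (rep t)); split=> [t|u uU]; first exact: (s2valP (rep t)).
exists (cell u); have := s2valP' (rep (cell u)) u uU erefl.
have := s2valP (rep (cell u)); move: (s2val _) => v vU E.
have Re_le1 (w : M) i j : w \is unitarymx -> `|complex.Re (w i j)| <= 1 /\ `|complex.Im (w i j)| <= 1.
  move=> wU; have := normc_unitary i j wU.
  rewrite -(@expr_le1 _ 2) ?normc_ge0 // sqr_normc => le1.
  split; rewrite -(@expr_le1 _ 2) ?normr_ge0 // real_normK ?num_real //;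
  by apply: le_trans le1; rewrite ?lerDl ?lerDr sqr_ge0.
apply: (@le_trans _ _ (\sum_(i < n) \sum_(j < n) (K%:R^-1 + K%:R^-1))).
  apply: ler_sum => i _; apply: ler_sum => j _.
  have := congr1 (fun f : T => f (i, j)) E; rewrite !ffunE /= => -[E1 E2].
  have [u1 u2] := Re_le1 u i j uU; have [v1 v2] := Re_le1 v i j vU.
  rewrite sqr_normc !mxE !raddfB /= lerD //; exact: qP.
rewrite !sumr_const !card_ord -mulr2n -!mulrnA mulnC -[X in X <= _]mulr_natl.
by rewrite ler_pdivrMr // mulnAC mulnC -mulnA mulnC.
Qed.

(* The nets [e i *m u] and [e] both have minimal cardinality, so Hall's condition
   holds for the relation "some unitary is close to both", and the matching moves
   every point by at most twice the mesh. *)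
Lemma unitary_net_balanced (eps : R) : 0 < eps ->
  exists (N : nat) (e : 'I_N.+1 -> M), (forall i, e i \is unitarymx) /\
    forall u : M, u \is unitarymx ->
      exists2 s : 'I_N.+1 -> 'I_N.+1, injective s &
        forall i a b, normc ((e i *m u) a b - e (s i) a b) <= eps.
Proof.
(* [frob2] is a squared norm: the mesh is [eps / 2], so entries of matched points differ by at most
   [eps]. *)
move=> eps0; pose d := (eps / 2) ^+ 2.
have d0 : 0 < d by rewrite exprn_gt0 // divr_gt0.
pose P k := `[< exists e : 'I_k -> M, unitary_net d e >].
have PI (I : finType) (e : I -> M) : unitary_net d e -> P #|I|.
  move=> [eU eN]; apply/asboolP; exists (e \o enum_val); split=> [i|u /eN[i ui]].
    exact: eU.
  by exists (enum_rank i); rewrite /= enum_rankK.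
have exP : exists k, P k by have [I [e /PI ?]] := unitary_net_exists d0; exists #|I|.
case: (ex_minnP exP) => -[|N] /asboolP[e [eU eN]] kmin.
  have [|[]//] := eN 1%:M; by apply/unitarymxP; rewrite trmx1 map_mx1 mulmx1.
exists N, e; split=> // u uU.
pose near i j := `[< exists g : M, frob2 (g - e i *m u) <= d /\ frob2 (g - e j) <= d >].
have [|s sinj snear] := @hall_marriage _ _ near ord0.
  move=> X; pose Y := [set y | [exists x in X, near x y]]%SET.
  rewrite -/Y leqNgt; apply/negP => YX.
  (* If [X] had fewer neighbours than elements, the translates indexed outside [X] together with the
     points of [Y] would form a smaller net: when [g] is close to [e i *m u] with [i] in [X], it is
     also close to some [e j], and [g] itself witnesses [near i j]. *)
  pose J := ({i : 'I_N.+1 | i \notin X} + {j : 'I_N.+1 | j \in Y})%type.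
  pose e' (k : J) := match k with inl i => e (val i) *m u | inr j => e (val j) end.
  have : unitary_net d e'.
    split=> [[i|j]|g gU]; [exact: (mul_unitarymx (eU _) uU)|exact: eU|].
    have usU : u^t* \is unitarymx by rewrite (trmxC_unitary u).
    have [i gi] := eN (g *m u^t*) (mul_unitarymx gU usU).
    have gi' : frob2 (g - e i *m u) <= d.
      rewrite -(frob2_mulr_unitary (_ - e i) uU) mulmxBl (mulmxKtV _ uU erefl) in gi.
      exact: gi.
    have [iX|iX] := boolP (i \in X); last by exists (inl (exist _ i iX)).
    have [j gj] := eN g gU.
    have jY : j \in Y.
      rewrite inE; apply/existsP; exists i; rewrite iX /=.
      by apply/asboolP; exists g.
    by exists (inr (exist _ j jY)).
  move=> /PI/kmin; rewrite card_sum !card_sig leqNgt => /negP[].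
  rewrite -[X in (_ < X)%N](card_ord N.+1) -(cardC (mem X)) addnC.
  by rewrite (_ : #|[pred x in Y]| = #|Y|) ?ltn_add2r //; apply: eq_card.
exists s => // i a b; have /asboolP[g [g1 g2]] := snear i.
have H (v : M) : frob2 (g - v) <= d -> normc (g a b - v a b) <= eps / 2.
  move=> gv; rewrite -(@ler_pXn2r _ 2) ?nnegrE ?normc_ge0 //; last by apply/ltW;
    rewrite divr_gt0.
  by apply: le_trans gv; have := sqr_normc_frob2 (g - v) a b; rewrite !mxE.
have -> : (e i *m u) a b - e (s i) a b =
    ((e i *m u) a b - g a b) + (g a b - e (s i) a b) by rewrite addrA subrK.
apply: le_trans (le_normcD _ _) _.
by rewrite (splitr eps) lerD ?H // normcB H.
Qed.

End UnitaryNet.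

(** * Corners of infinite Hermitian matrices *)

Section Corner.
Variable R : realType.
Local Notation C := R[i].
Implicit Types (u v : Uinf R) (h : infherm R).

Definition corner_mx (n : nat) (a : nat -> nat -> C) : 'M[C]_n :=
  \matrix_(i < n, j < n) a i j.

(** The copy of U(n) inside U(oo): [in_Uinf] with its bound exposed, so that several elements can be
    brought to a common level. *)
Definition Uinf_level (n : nat) (a : nat -> nat -> C) :=
  [/\ corner_mx n a \is unitarymx,
      forall i, (n <= i)%N -> a i i = 1 &
      forall i j, i != j -> (n <= maxn i j)%N -> a i j = 0].

Lemma Uinf_level_exists u : exists n, Uinf_level n u.
Proof. exact: Uinf_valP u. Qed.

Lemma Uinf_level0 n u i k : Uinf_level n u -> (i < n)%N -> (n <= k)%N ->
  u i k = 0.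
Proof.
move=> [_ _ H] iN nk; apply: H; last by rewrite leq_max nk orbT.
by rewrite neq_ltn (leq_trans iN nk).
Qed.

Lemma Uinf_level_leq n N u : (n <= N)%N -> Uinf_level n u -> Uinf_level N u.
Proof.
move=> nN [U1 U2 U3]; have L : forall i k, (i < N)%N -> (N <= k)%N -> u i k = 0.
  move=> i k iN Nk; apply: U3; first by rewrite neq_ltn (leq_trans iN Nk).
  by rewrite leq_max (leq_trans nN Nk) orbT.
split=> [|i Ni|i j ij Nij]; last 2 first.
- by apply: U2; apply: leq_trans Ni.
- by apply: U3 => //; apply: leq_trans Nij.
apply/unitarymxP/matrixP => i j; rewrite !mxE.
have := congr1 (fun a => a (i : nat) (j : nat)) (Uinf_mulV u).
rewrite (@infmx_mulE _ N) => [E|k Nk]; last by rewrite L ?mul0r.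
rewrite /infmx1 in E; rewrite -[RHS]E.
by apply: eq_bigr => k _; rewrite !mxE.
Qed.

Lemma corner_mx_act n u h : Uinf_level n u ->
  corner_mx n (Uinf_act u h) =
  corner_mx n u *m corner_mx n h *m (corner_mx n u)^t*.
Proof.
move=> L; apply/matrixP => i j; rewrite !mxE /=.
rewrite (@infmx_mulE _ n) => [|k nk]; last first.
  by rewrite /= /infmx_adj (Uinf_level0 L (ltn_ord j) nk) rmorph0 mulr0.
apply: eq_bigr => k _; rewrite !mxE; congr (_ * _).
rewrite (@infmx_mulE _ n) => [|l nl]; first by apply: eq_bigr => l _; rewrite !mxE.
by rewrite (Uinf_level0 L (ltn_ord i) nl) mul0r.
Qed.

Lemma Uinf_embed n (V : 'M[C]_n) : V \is unitarymx ->
  exists2 u : Uinf R, Uinf_level n u & corner_mx n u = V.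
Proof.
move=> VU; pose a (i j : nat) : C :=
  if insub i is Some i' then if insub j is Some j' then V i' j' else 0
  else (i == j)%:R.
have aV : corner_mx n a = V.
  by apply/matrixP => i j; rewrite mxE /a !valK.
have aL : Uinf_level n a.
  split=> [|i ni|i j ij]; first by rewrite aV.
    by rewrite /a insubF ?eqxx // ltnNge ni.
  rewrite leq_max /a; case: insubP => [i' i'n ii'|]; last by rewrite (negbTE ij).
  case: insubP => [j' j'n jj'|//].
  by rewrite leqNgt i'n leqNgt j'n.
by exists (MkUinf (ex_intro _ n aL)).
Qed.

Lemma Uinf_actVK u : cancel (Uinf_act (Uinf_inv u)) (Uinf_act u).
Proof.
move=> h; apply: (@infherm_inj R); apply/funext => i; apply/funext => j.
have [n L] := Uinf_level_exists u; have [n' L'] := Uinf_level_exists (Uinf_inv u).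
(* A corner that contains the entry [(i, j)] and in which [u] and its inverse both live; there the
   action is conjugation of finite matrices. *)
pose N := (n + n' + i.+1 + j.+1)%N.
have {}L : Uinf_level N u by apply: Uinf_level_leq L; rewrite /N; lia.
have {}L' : Uinf_level N (Uinf_inv u) by apply: Uinf_level_leq L'; rewrite /N; lia.
have iN : (i < N)%N by rewrite /N; lia.
have jN : (j < N)%N by rewrite /N; lia.
have E : corner_mx N (Uinf_act u (Uinf_act (Uinf_inv u) h)) = corner_mx N h.
  rewrite !corner_mx_act // (_ : corner_mx N (Uinf_inv u) = (corner_mx N u)^t*).
    case: L => U _ _; rewrite trmxCK !mulmxA mulmxtVK //.
    by rewrite (unitarymxP U) mul1mx.
  by apply/matrixP => k l; rewrite !mxE.
by have := congr1 (fun M : 'M[C]_N => M (Ordinal iN) (Ordinal jN)) E; rewrite !mxE.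
Qed.

Lemma corner_norm_ge0 m h : 0 <= corner_norm m h.
Proof.
rewrite /corner_norm; elim/big_ind : _ => // [x y x0 y0|i _].
  by rewrite le_max x0.
by elim/big_ind : _ => // [x y x0 y0|j _]; rewrite ?le_max ?x0 ?normc_ge0.
Qed.

Lemma corner_norm_leP m h r : 0 <= r ->
  reflect (forall i j, (i < m)%N -> (j < m)%N -> normc (h i j) <= r)
          (corner_norm m h <= r).
Proof.
move=> r0; apply: (iffP idP) => [le i j im jm|H].
  apply: le_trans le; rewrite /corner_norm.
  apply: le_trans (le_bigmax _ _ (Ordinal im)).
  exact: le_trans (le_bigmax _ _ (Ordinal jm)).
by apply/bigmax_leP; split=> // i _; apply/bigmax_leP; split=> // j _; apply: H.
Qed.

Lemma normc_le_corner_norm m h i j : (i < m)%N -> (j < m)%N ->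
  normc (h i j) <= corner_norm m h.
Proof.
by move=> im jm; have /corner_norm_leP := lexx (corner_norm m h); apply;
  rewrite ?corner_norm_ge0.
Qed.

Lemma corner_norm_leq m n h : (m <= n)%N -> corner_norm m h <= corner_norm n h.
Proof.
move=> mn; apply/corner_norm_leP => [|i j im jm]; first exact: corner_norm_ge0.
by apply: normc_le_corner_norm; apply: leq_trans mn.
Qed.

Lemma corner_norm_lipschitz m h h' d : 0 <= d ->
  (forall i j, (i < m)%N -> (j < m)%N -> normc (h i j - h' i j) <= d) ->
  `|corner_norm m h - corner_norm m h'| <= d.
Proof.
move=> d0 H; have le (k k' : infherm R) :
  (forall i j, (i < m)%N -> (j < m)%N -> normc (k i j - k' i j) <= d) ->
  corner_norm m k <= corner_norm m k' + d.
  move=> E; apply/corner_norm_leP => [|i j im jm];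
    first by rewrite addr_ge0 ?corner_norm_ge0.
  rewrite -[k i j](subrK (k' i j)) addrC; apply: le_trans (le_normcD _ _) _.
  by rewrite lerD ?E ?normc_le_corner_norm.
have hh' : corner_norm m h <= corner_norm m h' + d by apply: le.
have h'h : corner_norm m h' <= corner_norm m h + d.
  by apply: le => i j im jm; rewrite normcB; apply: H.
by rewrite ler_norml; apply/andP; split; lra.
Qed.

(** Row [i] of [A] lies in the span of the first [i + 1] rows of [schmidt A], all of them orthogonal
    to row [k]. *)
Lemma schmidt_triangular p (A : 'M[C]_p) (i k : 'I_p) : (i < k)%N ->
  (A *m (schmidt A)^t*) i k = 0.
Proof.
move=> ik; have SU : schmidt A \is unitarymx by apply: schmidt_unitarymx.
have sub : (\sum_(l < p | (l <= i)%N) <<row l (schmidt A)>> <=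
    kermx (col k ((schmidt A)^t*)))%MS.
  apply/sumsmx_subP => l li; rewrite genmxE; apply/sub_kermxP.
  apply/matrixP => a b; rewrite mxE [RHS]mxE.
  have /matrixP/(_ l k) := unitarymxP SU.
  rewrite !mxE (_ : l == k = false);
    last by rewrite -val_eqE ltn_eqF // (leq_ltn_trans li).
  by rewrite mulr0n => E; rewrite -[RHS]E; apply: eq_bigr => j _; rewrite !mxE.
have /sub_kermxP/matrixP/(_ ord0 ord0) := submx_trans (row_schmidt_sub A i) sub.
by rewrite mxE [RHS]mxE => E; rewrite mxE -[RHS]E; apply: eq_bigr => j _; rewrite !mxE.
Qed.

(* Acting by [v = 1 (+) Q], with [Q] from Gram-Schmidt, leaves the m-corner
   unchanged and makes the first m rows of [u v] vanish beyond column 2m. *)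
Lemma Uinf_reduce m u : exists v : Uinf R,
  (forall h, corner_norm m (Uinf_act v h) = corner_norm m h) /\
  (forall h, corner_norm m (Uinf_act u (Uinf_act v h)) <=
             ((m + m) ^ 2)%:R * corner_norm (m + m) h).
Proof.
have [q Lq] := Uinf_level_exists u.
(* Beyond the [m] fixed coordinates, [m] more receive the image of Gram-Schmidt; [q] makes [n] large
   enough to be a level of [u]. *)
pose n := (m + (m + q))%N.
have {Lq}L : Uinf_level n u by apply: Uinf_level_leq Lq; rewrite /n; lia.
pose U : 'M[C]_(m + (m + q)) := corner_mx n u.
(* The first [m] rows of [u] beyond column [m], padded by zero rows to a square matrix. By
   triangularity, the first [m] rows of [A *m Q] are supported on the first [m] columns. *)
pose A : 'M[C]_(m + q) := col_mx (ursubmx U) 0.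
pose Q := (schmidt A)^t*.
have QU : Q \is unitarymx by rewrite trmxC_unitary; apply: schmidt_unitarymx.
pose V : 'M[C]_(m + (m + q)) := block_mx 1%:M 0 0 Q.
have VU : V \is unitarymx.
  apply/unitarymxP; rewrite tr_block_mx map_block_mx mulmx_block.
  by rewrite !trmx0 !map_mx0 !mulmx0 !mul0mx trmx1 map_mx1 mulmx1 !addr0 add0r
     (unitarymxP QU) -scalar_mx_block.
have [v Lv vV] := Uinf_embed VU.
exists v; split=> h.
  apply: eq_bigr => i _; apply: eq_bigr => j _; congr normc.
  have := congr1 (fun M : 'M[C]_n => M (lshift (m + q) i) (lshift (m + q) j))
     (corner_mx_act h Lv).
  rewrite mxE vV => ->.
  rewrite -[corner_mx n h]submxK.
  rewrite tr_block_mx map_block_mx !mulmx_block block_mxEul.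
  by rewrite !trmx0 !map_mx0 !mulmx0 !mul0mx trmx1 map_mx1 mulmx1 !addr0 mul1mx !mxE.
pose X : 'M[C]_n := U *m V.
have UU : U \is unitarymx by case: L.
have XU : X \is unitarymx by exact: (mul_unitarymx UU VU).
have X0 (i k : 'I_n) : (i < m)%N -> (m + m <= k)%N -> X i k = 0.
  move=> im mk.
  rewrite /X -[U]submxK mulmx_block !mulmx0 !mulmx1 add0r addr0.
  have -> : i = lshift (m + q) (Ordinal im) by apply/val_inj.
  have km : (k - m < m + q)%N by have := ltn_ord k; rewrite /n; lia.
  have -> : k = rshift m (Ordinal km) by apply/val_inj => /=; lia.
  rewrite block_mxEur.
  have := @schmidt_triangular _ A (lshift q (Ordinal im)) (Ordinal km).
  by rewrite mul_col_mx col_mxEu; apply => /=; lia.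
have E : corner_mx n (Uinf_act u (Uinf_act v h)) = X *m corner_mx n h *m X^t*.
  by rewrite !corner_mx_act // vV /X trmx_mul map_mxM !mulmxA.
move: X XU X0 E => X XU X0 E; set c := corner_norm (m + m) h.
have c0 : 0 <= c by apply: corner_norm_ge0.
apply/corner_norm_leP => [|i j im jm]; first by rewrite mulr_ge0.
have iN : (i < n)%N by rewrite /n; lia.
have jN : (j < n)%N by rewrite /n; lia.
have := congr1 (fun M : 'M[C]_n => M (Ordinal iN) (Ordinal jN)) E.
rewrite mxE /= => ->; rewrite mxE.
have mn : (m + m <= n)%N by rewrite /n; lia.
(* Used once for each of the two sums in the conjugation: only [m + m] terms of each survive, which
   produces the factor [(m + m) ^ 2]. *)
have bnd (F : 'I_n -> C) (b : R) : 0 <= b -> (forall k : 'I_n, (m + m <= k)%N -> F k = 0) ->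
    (forall k : 'I_n, (k < m + m)%N -> normc (F k) <= b) ->
    normc (\sum_k F k) <= (m + m)%:R * b.
  move=> b0 F0 Fb; rewrite (bigID (fun k : 'I_n => (k < m + m)%N)) /=.
  rewrite [X in _ + X]big1 => [|k]; last by rewrite -leqNgt => /F0.
  rewrite addr0 big_ord_narrow; apply: le_trans (normc_sum _ _ _) _.
  apply: (@le_trans _ _ (\sum_(k < m + m) b)).
    by apply: ler_sum => k _; apply: Fb => /=.
  by rewrite sumr_const card_ord mulr_natl.
rewrite expnS expn1 natrM -mulrA; apply: (bnd) => [|k mk|k km].
- by rewrite mulr_ge0.
- by rewrite !mxE (X0 (Ordinal jN)) // rmorph0 mulr0.
rewrite !mxE normcM -[X in _ <= X]mulr1 ler_pM ?normc_ge0 //; last first.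
  by rewrite normc_conj normc_unitary.
apply: bnd => // [l ml|l lm]; first by rewrite (X0 (Ordinal iN)) ?mul0r.
rewrite !mxE normcM -[X in _ <= X]mul1r ler_pM ?normc_ge0 ?normc_unitary //.
exact: normc_le_corner_norm.
Qed.

End Corner.

(** * Measurability of entries, corner norms and the action *)

Section Measurability.
Variable R : realType.
Local Notation C := R[i].
Local Notation H := (infherm R).

Lemma continuous_entry (i j : nat) : continuous (fun h : H => (h i j : C^o)).
Proof.
move=> h; apply: (@continuous_comp H _ _ (fun h => infherm_entries h i)
  (fun r : {ptws nat -> C^o} => r j)); last exact: (@proj_continuous nat (fun=> C^o)).
apply: (@continuous_comp H _ _ (@infherm_entries R) (fun r => r i)); last first.
  exact: (@proj_continuous nat (fun=> {ptws nat -> C^o})).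
exact: (@initial_continuous (infherm R) _ (@infherm_entries R)).
Qed.

Lemma continuous_measurable_infherm (f : H -> R) :
  continuous f -> measurable_fun [set: H] f.
Proof.
move=> /continuousP cf; apply: (measurability _ (RGenOpens.measurableE R)).
move=> _ [_ [a [b ->] <-]]; rewrite setTI.
by apply: sub_sigma_algebra; apply: cf; apply: interval_open.
Qed.

Lemma continuous_contraction (f : C -> R) :
  (forall x y, `|f x - f y| <= normc (x - y)) ->
  continuous (fun x : C^o => f x).
Proof.
move=> fxy x A /nbhs_ballP[e /= e0 eA].
have : nbhs (x : C^o) (ball (x : C^o) e%:C%C) by apply: nbhsx_ballx; rewrite ltcR.
apply: filterS => y; rewrite -ball_normE /= ltcR => xy; apply: eA.
by rewrite -ball_normE /=; apply: le_lt_trans xy; exact: fxy.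
Qed.

(** Going through the two real coordinates reduces complex sums and scalar multiples to real
    measurable functions. *)
Definition cmeasurable (f : H -> C) :=
  measurable_fun [set: H] (@complex.Re R \o f) /\ measurable_fun [set: H] (@complex.Im R \o f).

Lemma cmeasurable_entry i j : cmeasurable (fun h => h i j).
Proof.
have Re_le (z : C) : `|complex.Re z| <= normc z /\ `|complex.Im z| <= normc z.
  by split; rewrite normc_sqrtE -[X in X <= _]sqrtr_sqr ler_wsqrtr // ?lerDl ?lerDr sqr_ge0.
split; apply: continuous_measurable_infherm => h.
  apply: (@continuous_comp H C^o R (fun h => h i j) (@complex.Re R)).
    exact: continuous_entry.
  by apply: continuous_contraction => -[a b] [c d];
    case: (Re_le ((a +i* b) - (c +i* d))%C).
apply: (@continuous_comp H C^o R (fun h => h i j) (@complex.Im R)).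
  exact: continuous_entry.
by apply: continuous_contraction => -[a b] [c d];
  case: (Re_le ((a +i* b) - (c +i* d))%C).
Qed.

Lemma cmeasurableZ (a : C) f : cmeasurable f -> cmeasurable (fun h => a * f h).
Proof.
case: a => x y [fr fi]; split.
  rewrite (_ : _ \o _ = (fun h => x * complex.Re (f h)) \- (fun h => y * complex.Im (f h))).
    by apply: measurable_funB; apply: measurableT_comp.
  by apply/funext => h /=; case: (f h).
rewrite (_ : _ \o _ = (fun h => x * complex.Im (f h)) \+ (fun h => y * complex.Re (f h))).
  by apply: measurable_funD; apply: measurableT_comp.
by apply/funext => h /=; case: (f h).
Qed.

Lemma cmeasurable_sum n (F : 'I_n -> H -> C) :
  (forall k, cmeasurable (F k)) -> cmeasurable (fun h => \sum_k F k h).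
Proof.
move=> mF; split.
  rewrite (_ : _ \o _ = fun h => \sum_k complex.Re (F k h)).
    by apply: measurable_sum => k; case: (mF k).
  by apply/funext => h /=; rewrite raddf_sum.
rewrite (_ : _ \o _ = fun h => \sum_k complex.Im (F k h)).
  by apply: measurable_sum => k; case: (mF k).
by apply/funext => h /=; rewrite raddf_sum.
Qed.

Lemma cmeasurable_act (u : Uinf R) i j : cmeasurable (fun h => Uinf_act u h i j).
Proof.
have [n L] := Uinf_level_exists u; pose N := (n + i.+1 + j.+1)%N.
have {}L : Uinf_level N u by apply: Uinf_level_leq L; rewrite /N; lia.
have iN : (i < N)%N by rewrite /N; lia.
have jN : (j < N)%N by rewrite /N; lia.
rewrite (_ : (fun h : H => _) = fun h : H => \sum_(k < N) (u j k)^*%R *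
    \sum_(l < N) u i l * h l k).
  apply: cmeasurable_sum => k; apply: cmeasurableZ; apply: cmeasurable_sum => l.
  by apply: cmeasurableZ; exact: cmeasurable_entry.
apply/funext => h.
have := congr1 (fun M : 'M[C]_N => M (Ordinal iN) (Ordinal jN)) (corner_mx_act h L).
rewrite mxE => ->; rewrite mxE; apply: eq_bigr => k _; rewrite !mxE mulrC.
by congr (_ * _); apply: eq_bigr => l _; rewrite !mxE.
Qed.

Lemma measurable_sqr_normc f : cmeasurable f ->
  measurable_fun [set: H] (fun h => normc (f h) ^+ 2).
Proof.
move=> [fr fi]; rewrite (_ : (fun h => _) =
  (fun h => complex.Re (f h) ^+ 2) \+ (fun h => complex.Im (f h) ^+ 2)).
  by apply: measurable_funD; apply: measurable_funX.
by apply/funext => h /=; rewrite sqr_normc.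
Qed.

Lemma measurable_normc f : cmeasurable f ->
  measurable_fun [set: H] (fun h => normc (f h)).
Proof.
move=> mf; rewrite (_ : (fun h => _) = Num.sqrt \o (fun h => normc (f h) ^+ 2)).
  apply: measurableT_comp; last exact: measurable_sqr_normc.
  by apply: continuous_measurable_fun; exact: sqrt_continuous.
by apply/funext => h /=; rewrite sqrtr_sqr ger0_norm // normc_ge0.
Qed.

Lemma measurable_bigmaxr (I : Type) (r : seq I) (F : I -> H -> R) :
  (forall k, measurable_fun [set: H] (F k)) ->
  measurable_fun [set: H] (fun h => \big[Num.max/0]_(k <- r) F k h).
Proof.
move=> mF; elim: r => [|k r IH].
  by under eq_fun do rewrite big_nil; exact: measurable_cst.
by under eq_fun do rewrite big_cons; exact: measurable_maxr.
Qed.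

Lemma measurable_corner_norm_act m (u : Uinf R) :
  measurable_fun [set: H] (fun h => corner_norm m (Uinf_act u h)).
Proof.
apply: measurable_bigmaxr => i; apply: measurable_bigmaxr => j.
by apply: measurable_normc; exact: cmeasurable_act.
Qed.

Lemma measurable_corner_norm m : measurable_fun [set: H] (@corner_norm R m).
Proof.
apply: measurable_bigmaxr => i; apply: measurable_bigmaxr => j.
by apply: measurable_normc; exact: cmeasurable_entry.
Qed.

Lemma measurable_frob2_corner n :
  measurable_fun [set: H] (fun h => frob2 (corner_mx n h)).
Proof.
apply: measurable_sum => i; apply: measurable_sum => j.
under eq_fun do rewrite mxE.
by apply: measurable_sqr_normc; exact: cmeasurable_entry.
Qed.

End Measurability.

(** * Limits of tail hulls *)

Section TailHull.
Context {d} {T : measurableType d} {R : realType}.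
Variable mu : {measure set T -> \bar R}.
Variable F : nat -> T -> R.

(** Midpoints suffice for the parallelogram law, and the inductive form lets bounds, integrals and
    almost invariance pass from [F] to the hull by induction. *)
Inductive tail_hull (j : nat) : (T -> R) -> Prop :=
| tail_hull_base n : (j <= n)%N -> tail_hull j (F n)
| tail_hull_mid f g : tail_hull j f -> tail_hull j g ->
    tail_hull j (fun x => (f x + g x) / 2).

Lemma tail_hull_leq i j f : (i <= j)%N -> tail_hull j f -> tail_hull i f.
Proof.
move=> ij; elim=> [n jn|g h _ IHg _ IHh]; last exact: tail_hull_mid.
by apply: tail_hull_base; apply: leq_trans jn.
Qed.

Hypothesis F_meas : forall n, measurable_fun [set: T] (F n).
Hypothesis F01 : forall n x, 0 <= F n x <= 1.
Variable M : R.
Hypothesis F_int : forall n, (\int[mu]_x (F n x)%:E <= M%:E)%E.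

Lemma tail_hull_measurable j f : tail_hull j f -> measurable_fun [set: T] f.
Proof.
elim=> [n _|g h _ mg _ mh]; first exact: F_meas.
by apply: (measurable_funM (measurable_funD mg mh)); exact: measurable_cst.
Qed.

Lemma tail_hull01 j f x : tail_hull j f -> 0 <= f x <= 1.
Proof.
elim=> [n _|g h _ /andP[g0 g1] _ /andP[h0 h1]]; first exact: F01.
by apply/andP; split; lra.
Qed.

Let tail_hull_measE j f : tail_hull j f -> measurable_fun [set: T] (EFin \o f).
Proof. by move=> /tail_hull_measurable mf; exact/measurable_EFinP. Qed.

Lemma integral_mid (D : set T) (f g : T -> R) : measurable D ->
  measurable_fun [set: T] f -> measurable_fun [set: T] g ->
  (forall x, 0 <= f x) -> (forall x, 0 <= g x) ->
  (\int[mu]_(x in D) ((f x + g x) / 2)%:E =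
   (2^-1)%:E * (\int[mu]_(x in D) (f x)%:E + \int[mu]_(x in D) (g x)%:E))%E.
Proof.
move=> mD mf mg f0 g0.
have mE (h : T -> R) : measurable_fun [set: T] h -> measurable_fun D (EFin \o h).
  by move=> mh; apply/measurable_EFinP; apply: measurable_funS mh.
rewrite -ge0_integralD //; first last.
- exact: mE.
- by move=> x _; rewrite lee_fin.
- exact: mE.
- by move=> x _; rewrite lee_fin.
rewrite -ge0_integralZl_EFin //; last 2 first.
- move=> x _; rewrite adde_ge0 // lee_fin //.
- by apply: emeasurable_funD; exact: mE.
by apply: eq_integral => x _; rewrite -EFinD -EFinM mulrC.
Qed.

Lemma tail_hull_int j f : tail_hull j f -> (\int[mu]_x (f x)%:E <= M%:E)%E.
Proof.
elim=> [n _|g h hg IHg hh IHh]; first exact: F_int.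
rewrite integral_mid //; last 4 first.
- exact: tail_hull_measurable hg.
- exact: tail_hull_measurable hh.
- by move=> x; case/andP: (tail_hull01 x hg).
- by move=> x; case/andP: (tail_hull01 x hh).
apply: (@le_trans _ _ ((2^-1)%:E * (M%:E + M%:E))%E).
  by rewrite lee_pmul2l // ?lee_fin // leeD.
by rewrite -EFinD -EFinM lee_fin; lra.
Qed.

Lemma tail_hull_int_ge (A : set T) (c : R) j f : measurable A ->
  (forall n, (c%:E <= \int[mu]_(x in A) (F n x)%:E)%E) ->
  tail_hull j f -> (c%:E <= \int[mu]_(x in A) (f x)%:E)%E.
Proof.
move=> mA Fc; elim=> [n _|g h hg IHg hh IHh]; first exact: Fc.
rewrite integral_mid //; last 4 first.
- exact: tail_hull_measurable hg.
- exact: tail_hull_measurable hh.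
- by move=> x; case/andP: (tail_hull01 x hg).
- by move=> x; case/andP: (tail_hull01 x hh).
apply: (@le_trans _ _ ((2^-1)%:E * (c%:E + c%:E))%E).
  by rewrite -EFinD -EFinM lee_fin; lra.
by rewrite lee_pmul2l // ?lee_fin // leeD.
Qed.

Let sqint (f : T -> R) : \bar R := (\int[mu]_x ((f x) ^+ 2)%:E)%E.

Let sqint_ge0 f : (0 <= sqint f)%E.
Proof. by apply: integral_ge0 => x _; rewrite lee_fin sqr_ge0. Qed.

Let sq_meas (f : T -> R) : measurable_fun [set: T] f ->
  measurable_fun [set: T] (fun x => ((f x) ^+ 2)%:E).
Proof. by move=> mf; apply/measurable_EFinP; exact: measurable_funX. Qed.

Let sqint_le j f : tail_hull j f -> (sqint f <= M%:E)%E.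
Proof.
move=> hf; apply: le_trans (tail_hull_int hf).
apply: ge0_le_integral => //.
- by move=> x _; rewrite lee_fin sqr_ge0.
- exact/sq_meas/(tail_hull_measurable hf).
- exact: tail_hull_measE hf.
- move=> x _; have /andP[f0 f1] := tail_hull01 x hf.
  by rewrite lee_fin expr2 ler_piMl.
Qed.

Let sqint_fin j f : tail_hull j f -> sqint f = (fine (sqint f))%:E.
Proof.
move=> hf; rewrite fineK // ge0_fin_numE //.
by apply: le_lt_trans (sqint_le hf) _; rewrite ltry.
Qed.

Let parallelogram (f g : T -> R) : measurable_fun [set: T] f -> measurable_fun [set: T] g ->
  (sqint (fun x => f x - g x)%R + 4%:E * sqint (fun x => (f x + g x) / 2)%R =
   2%:E * sqint f + 2%:E * sqint g)%E.
Proof.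
move=> mf mg.
have mB : measurable_fun [set: T] (fun x => f x - g x) by exact: measurable_funB.
have mD : measurable_fun [set: T] (fun x => (f x + g x) / 2).
  by apply: (measurable_funM (measurable_funD mf mg)); exact: measurable_cst.
have sq0 (h : T -> R) (k : R) : 0 <= k -> forall x, [set: T] x -> (0 <= k%:E * ((h x) ^+ 2)%:E)%E.
  by move=> k0 x _; rewrite -EFinM lee_fin mulr_ge0 // sqr_ge0.
have mZ (h : T -> R) (k : R) : measurable_fun [set: T] h ->
    measurable_fun [set: T] (fun x => k%:E * ((h x) ^+ 2)%:E)%E.
  by move=> mh; apply: emeasurable_funM; [exact: measurable_cst|exact: sq_meas].
rewrite /sqint -!ge0_integralZl_EFin //; try exact: sq_meas;
  try by move=> x _; rewrite lee_fin sqr_ge0.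
rewrite -!ge0_integralD //; try (by apply: mZ); try (by apply: sq_meas);
  try (by apply: sq0); try by move=> x _; rewrite lee_fin sqr_ge0.
by apply: eq_integral => x _; rewrite -!EFinM -!EFinD; congr EFin; field.
Qed.

(** The infima of the squared L^2 norm over the tail hulls increase to a finite limit. Two nearly
    minimal elements of one hull have their midpoint in that hull, so its norm is not much smaller,
    and the parallelogram law forces the two to be close. *)
Lemma tail_hull_cauchy : exists g : nat -> T -> R,
  (forall k, tail_hull k (g k)) /\
  forall k, (\int[mu]_x ((g k.+1 x - g k x) ^+ 2)%:E <= (8 * 8^-1 ^+ k)%:E)%E.
Proof.
pose S j := [set r | exists2 f, tail_hull j f & r = fine (sqint f)].
have S_lb j : has_lbound (S j).
  by exists 0 => _ [f _ ->]; rewrite fine_ge0.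
have S_inf j : has_inf (S j).
  split=> //; exists (fine (sqint (F j))), (F j) => //; exact: tail_hull_base.
have inf_le j f : tail_hull j f -> inf (S j) <= fine (sqint f).
  by move=> hf; apply: ge_inf => //; exists f.
have inf_mono i j : (i <= j)%N -> inf (S i) <= inf (S j).
  move=> ij; apply: lb_le_inf; first by case: (S_inf j).
  by move=> _ [f hf ->]; apply: inf_le; apply: tail_hull_leq hf.
pose D := [set inf (S j) | j in [set: nat]].
have D_sup : has_sup D.
  split; first by exists (inf (S 0%N)), 0%N.
  exists M => _ [j _ <-]; have hj : tail_hull j (F j) by exact: tail_hull_base.
  by apply: le_trans (inf_le _ _ hj) _; rewrite -lee_fin -(sqint_fin hj) (sqint_le hj).
(* The rate 1/8 beats the squared thresholds [(2^-1 ^+ k) ^+ 2] used in Chebyshev's inequality for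
   the increments. *)
pose e k : R := 8^-1 ^+ k.
have e0 k : 0 < e k by rewrite exprn_gt0.
have eS k : e k.+1 <= e k by rewrite /e exprS; have := e0 k; rewrite /e; lra.
have /choice[J HJ] k : exists j, sup D - e k < inf (S j).
  by have [_ [j _ <-] lt] := sup_adherent (e0 k) D_sup; exists j.
(* Cumulative sums make [j] monotone, with [j k] at least [k] and at least [J k]. *)
pose j k := (k + \sum_(i < k.+1) J i)%N.
have jS k : (j k <= j k.+1)%N by rewrite /j [X in (_ <= _ + X)%N]big_ord_recr /=; lia.
have Jj k : sup D - e k < inf (S (j k)).
  apply: lt_le_trans (HJ k) _; apply: inf_mono.
  by rewrite /j big_ord_recr /=; lia.
have supj k : inf (S (j k)) <= sup D by apply: ub_le_sup; [case: D_sup|exists (j k)].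
have /choice[g Hg] k : exists f, tail_hull (j k) f /\ fine (sqint f) < inf (S (j k)) + e k.
  by have [_ [f hf ->] lt] := inf_adherent (e0 k) (S_inf (j k)); exists f.
exists g; split=> k.
  by have [hg _] := Hg k; apply: tail_hull_leq hg; rewrite /j leq_addr.
have [h1 l1] := Hg k; have [h2' l2] := Hg k.+1.
have h2 : tail_hull (j k) (g k.+1) by apply: tail_hull_leq h2'.
have hm := tail_hull_mid h2 h1.
have := parallelogram (tail_hull_measurable h2) (tail_hull_measurable h1).
rewrite -/(sqint (fun x => g k.+1 x - g k x)).
(* Finiteness turns the extended-real parallelogram identity into a real one. There both squared
   norms are below [sup D + e k] and that of the midpoint is above [sup D - e k], which gives
   [8 * e k]. *)
have fin : sqint (fun x => g k.+1 x - g k x) \is a fin_num.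
  rewrite ge0_fin_numE //.
  have := parallelogram (tail_hull_measurable h2) (tail_hull_measurable h1).
  rewrite (sqint_fin h1) (sqint_fin h2) (sqint_fin hm) -!EFinM -EFinD.
  by case: (sqint _) (sqint_ge0 (fun x => g k.+1 x - g k x)) => [r _ _||//];
    rewrite ?ltry.
rewrite (sqint_fin h1) (sqint_fin h2) (sqint_fin hm) -(fineK fin) -!EFinM -!EFinD => -[E].
rewrite lee_fin -/(e k); have := inf_le _ _ hm; have := eS k.
have := Jj k; have := supj k; have := supj k.+1.
lra.
Qed.

Lemma measurable_superlevel (f : T -> R) (t : R) :
  measurable_fun [set: T] f -> measurable [set x | t < f x]%R.
Proof.
move=> mf; rewrite (_ : [set x | _] = [set: T] `&` f @^-1` `]t, +oo[); first exact: mf.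
by rewrite setTI; apply/seteqP; split=> x /=; rewrite in_itv /= andbT.
Qed.

Lemma measurable_superlevel_le (f : T -> R) (t : R) :
  measurable_fun [set: T] f -> measurable [set x | t <= f x]%R.
Proof.
move=> mf; rewrite (_ : [set x | _] = [set: T] `&` f @^-1` `[t, +oo[); first exact: mf.
by rewrite setTI; apply/seteqP; split=> x /=; rewrite in_itv /= andbT.
Qed.

Lemma markov_pow2 (f : T -> R) (t b : R) n : measurable_fun [set: T] f ->
  (forall x, 0 <= f x) -> 0 < t -> (\int[mu]_x ((f x) ^+ n)%:E <= b%:E)%E ->
  (mu [set x | t <= f x]%R <= (b / t ^+ n)%:E)%E.
Proof.
move=> mf f0 t0 le; set A := [set x | _].
have mA : measurable A by apply: measurable_superlevel_le.
have : ((t ^+ n)%:E * mu A <= b%:E)%E.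
  apply: le_trans le; rewrite -integral_cst //.
  apply: (@le_trans _ _ (\int[mu]_(x in A) ((f x) ^+ n)%:E)%E).
    apply: ge0_le_integral => //.
    - by move=> x _; rewrite lee_fin exprn_ge0 // ltW.
    - apply/measurable_EFinP; apply: measurable_funX; exact: measurable_funS mf.
    - by move=> x /= tf; rewrite lee_fin lerXn2r // nnegrE ?ltW // (lt_le_trans t0).
  apply: ge0_subset_integral => //.
  - by apply/measurable_EFinP; exact: measurable_funX.
  - by move=> x _; rewrite lee_fin exprn_ge0.
by move=> {}le; rewrite EFinM muleC lee_pdivlMl // ?exprn_gt0.
Qed.

(** If [g 0] stays below [t] and the increment from [g k] to [g k.+1] below [t * 2^-1 ^+ k.+1],
    every [g l] telescopes to less than [2 * t]. The exceptional sets [B i] thus cover the union,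
    and Markov's inequality makes their measures summable. *)
Lemma bigcup_superlevel_finite (g : nat -> T -> R) (t : R) : 0 < t ->
  (forall k, tail_hull k (g k)) ->
  (forall k, (\int[mu]_x ((g k.+1 x - g k x) ^+ 2)%:E <= (8 * 8^-1 ^+ k)%:E)%E) ->
  (mu (\bigcup_k [set x | 2 * t <= g k x]%R) < +oo)%E.
Proof.
move=> t0 hg gC.
have mg k : measurable_fun [set: T] (g k) by apply: tail_hull_measurable (hg k).
have mD k : measurable_fun [set: T] (fun x => `|g k.+1 x - g k x|).
  by apply: measurableT_comp => //; apply: measurable_funB.
pose B i := if i is k.+1 then [set x | t * 2^-1 ^+ k.+1 <= `|g k.+1 x - g k x| ]%R
            else [set x | t <= g 0%N x]%R.
have mB i : measurable (B i) by case: i => [|k]; apply: measurable_superlevel_le.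
have M0 : 0 <= M.
  rewrite -lee_fin; apply: le_trans (F_int 0%N); apply: integral_ge0 => x _.
  by rewrite lee_fin; case/andP: (F01 0%N x).
pose K := 2 * (M / t + 64 / t ^+ 2).
have K1 : 0 <= M / t by rewrite divr_ge0 // ltW.
have K2 : 0 <= 64 / t ^+ 2 by rewrite divr_ge0 // exprn_ge0 // ltW.
have muB i : (mu (B i) <= (K / (2 ^ (i + 1))%:R)%:E)%E.
  case: i => [|k].
    have g0 x : 0 <= g 0%N x by case/andP: (tail_hull01 x (hg 0%N)).
    have := @markov_pow2 (g 0%N) t M 1 (mg 0%N) g0 t0 (tail_hull_int (hg 0%N)).
    move=> /le_trans; apply; rewrite lee_fin expr1 /K add0n expn1.
    by rewrite mulrAC divff ?mul1r ?lerDl.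
  have t2 : 0 < t * 2^-1 ^+ k.+1 by rewrite mulr_gt0 // exprn_gt0.
  have g0 x : 0 <= `|g k.+1 x - g k x| by [].
  have gk : (\int[mu]_x (`|g k.+1 x - g k x| ^+ 2)%:E <= (8 * 8^-1 ^+ k)%:E)%E.
    apply: le_trans (gC k).
    by under eq_integral do rewrite real_normK ?num_real //.
  apply: le_trans (markov_pow2 (mD k) g0 t2 gk) _.
  rewrite lee_fin.
  have -> : (8 * 8^-1 ^+ k) / (t * 2^-1 ^+ k.+1) ^+ 2 = (64 / t ^+ 2) / (2 ^ k.+1)%:R.
    have E8 : (8 : R)^-1 ^+ k = ((2 ^+ k) ^+ 3)^-1 by rewrite exprVn exprAC -natrX.
    have p0 : (2 : R) ^+ k != 0 by rewrite expf_neq0.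
    have tn : t != 0 by rewrite gt_eqF.
    rewrite E8 natrX [2^-1 ^+ k.+1]exprVn [2 ^+ k.+1]exprS.
    by move: (2 ^+ k) p0 => w p0; field; rewrite tn p0.
  rewrite /K addn1 [in X in _ <= X]expnS (natrM _ 2%N) (invfM 2%:R) mulrACA divff // mul1r.
  by rewrite ler_wpM2r ?invr_ge0 ?ler0n // lerDr.
have sub : \bigcup_k [set x | 2 * t <= g k x]%R `<=` \bigcup_i B i.
  move=> x [k _ /= gk]; apply: contrapT => nB.
  have nBi i : ~ B i x by move=> Bi; apply: nB; exists i.
  have le l : g l x < t * (2 - 2^-1 ^+ l).
    elim: l => [|l IH].
      by have := nBi 0%N => /= /negP; rewrite -ltNge expr0; lra.
    have := nBi l.+1 => /= /negP; rewrite -ltNge exprS => lt.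
    have := ler_norm (g l.+1 x - g l x).
    by move: lt; move: (2^-1 ^+ l) IH => z; lra.
  have := le k; have : 0 < t * 2^-1 ^+ k by rewrite mulr_gt0 // exprn_gt0.
  by rewrite mulrBr; lra.
apply: (@le_lt_trans _ _ (\sum_(0 <= i <oo) mu (B i))%E).
  by apply: measure_sigma_subadditive => //; apply: bigcupT_measurable => k;
     apply: measurable_superlevel_le.
apply: (@le_lt_trans _ _ (\sum_(0 <= i <oo) (K / (2 ^ (i + 1))%:R)%:E)%E).
  by apply: lee_nneseries => // i _; apply: measure_ge0.
have /cvg_lim := @cvg_geometric_eseries_half R K 0.
by rewrite /eseries /= => -> //; rewrite ltry.
Qed.

(** On [A] each [g k] is at most the indicator of its superlevel set plus [t], so that set has
    measure at least [c - t * mu A] within [A]. As [mu A] is finite, continuity from above carries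
    this bound to the upper limit. *)
Lemma limsup_superlevel_gt0 (A : set T) (c t : R) (g : nat -> T -> R) :
  measurable A -> (mu A < +oo)%E -> 0 < t ->
  (t%:E * mu A < c%:E)%E ->
  (forall k, tail_hull k (g k)) ->
  (forall n, (c%:E <= \int[mu]_(x in A) (F n x)%:E)%E) ->
  (0 < mu (lim_sup_set (fun k => [set x | t < g k x]%R)))%E.
Proof.
move=> mA Afin t0 tc hg Fc.
have mg k : measurable_fun [set: T] (g k) by apply: tail_hull_measurable (hg k).
pose G k := A `&` [set x | t < g k x]%R.
have mG k : measurable (G k) by apply: measurableI => //; apply: measurable_superlevel.
have Gc k : (c%:E - t%:E * mu A <= mu (G k))%E.
  rewrite leeBlDr; last by rewrite fin_numM // ge0_fin_numE.
  apply: le_trans (tail_hull_int_ge mA Fc (hg k)) _.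
  have le x : A x -> ((g k x)%:E <= (\1_(G k) x)%:E + (cst t%:E) x)%E.
    move=> Ax; rewrite -EFinD lee_fin indicE.
    have /andP[g0 g1] := tail_hull01 x (hg k).
    have [xG|/negP xG] := boolP (x \in G k); first by rewrite /=; lra.
    rewrite add0r leNgt; apply/negP => tg; apply: xG.
    by rewrite inE; split.
  have m1 : measurable_fun A (fun x => (\1_(G k) x)%:E : \bar R).
    by apply/measurable_EFinP; apply: measurable_indic.
  apply: (@le_trans _ _ (\int[mu]_(x in A) ((\1_(G k) x)%:E + (cst t%:E) x))%E).
    apply: ge0_le_integral => //.
    - by move=> x _; rewrite lee_fin; case/andP: (tail_hull01 x (hg k)).
    - by apply/measurable_EFinP; apply: measurable_funS (mg k).
    - by apply: emeasurable_funD => //.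
  rewrite ge0_integralD //.
  - by rewrite integral_indic // integral_cst // (setIidl (@subIsetl _ _ _)).
  - by move=> x _; rewrite lee_fin ltW.
have sub : lim_sup_set G `<=` lim_sup_set (fun k => [set x | t < g k x]%R).
  by move=> x H n _; have [k nk [_ Gk]] := H n I; exists k.
have mlim (B : nat -> set T) : (forall k, measurable (B k)) -> measurable (lim_sup_set B).
  move=> mB; apply: bigcapT_measurable => n.
  by apply: bigcup_measurable.
apply: (@lt_le_trans _ _ (mu (lim_sup_set G))); last first.
  by apply: le_measure => //; rewrite inE; apply: mlim => // k;
    exact: measurable_superlevel.
apply: (@lt_le_trans _ _ (c%:E - t%:E * mu A)%E); first by rewrite sube_gt0.
have Gfin : (mu (\bigcup_(k >= 0) G k) < +oo)%E.
  apply: le_lt_trans Afin; apply: le_measure; rewrite ?inE //.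
    exact: bigcup_measurable.
  by move=> x [k _ []].
have cv := lim_sup_set_cvg mu G mG Gfin.
rewrite -(cvg_lim _ cv) //; apply: lime_ge; first by apply/cvg_ex; eexists; exact: cv.
apply: nearW => n; apply: le_trans (Gc n) _; apply: le_measure; rewrite ?inE //.
  exact: bigcup_measurable.
by move=> x Gx; exists n => /=.
Qed.

(* The midpoint hulls play the role of the convex hulls in Mazur's lemma: almost
   norm-minimal elements are Cauchy in L^2, which bounds their supremum. *)
Lemma tail_hull_limsup (A : set T) (c : R) :
  measurable A -> (mu A < +oo)%E -> 0 < c ->
  (forall n, (c%:E <= \int[mu]_(x in A) (F n x)%:E)%E) ->
  exists (g : nat -> T -> R) (s : R), (forall k, tail_hull k (g k)) /\
    let Z := \bigcup_p lim_sup_set (fun k => [set x | s + p.+1%:R^-1 < g k x]%R) in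
    [/\ measurable Z, (mu Z < +oo)%E & (0 < mu Z)%E].
Proof.
move=> mA Afin c0 Fc; have [g [hg gC]] := tail_hull_cauchy.
have mg k : measurable_fun [set: T] (g k) by apply: tail_hull_measurable (hg k).
pose a := fine (mu A).
have aE : mu A = a%:E by rewrite fineK // ge0_fin_numE.
have a0 : 0 <= a by rewrite fine_ge0.
(* The [+ 1] gives [t * mu A < c] and avoids a division by zero. *)
pose t := c / (a + 1).
have t0 : 0 < t by rewrite divr_gt0 //; lra.
(* The level [t / 2] leaves room on both sides: [Z] lies in the union of the superlevels at
   [2 * (t / 4)], which is finite, and for large [p] the level [t / 2 + p.+1%:R^-1] is below [t],
   which gives positivity. *)
exists g, (t / 2); split=> // Z.
have mS p : measurable (lim_sup_set (fun k => [set x | t / 2 + p.+1%:R^-1 < g k x]%R)).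
  apply: bigcapT_measurable => n; apply: bigcup_measurable => k _.
  exact: measurable_superlevel.
have mZ : measurable Z by apply: bigcupT_measurable.
split=> //.
- have t4 : 0 < t / 4 by rewrite divr_gt0.
  apply: le_lt_trans (bigcup_superlevel_finite t4 hg gC).
  apply: le_measure; rewrite ?inE //.
    by apply: bigcupT_measurable => k; apply: measurable_superlevel_le.
  move=> x [p _ H]; have [k _ /= gk] := H 0%N I; exists k => //=.
  have : 0 < p.+1%:R^-1 :> R by rewrite invr_gt0 ltr0n.
  by move: gk; move: (p.+1%:R^-1 : R) => e; lra.
- pose p := Num.truncn (t / 2)^-1.
  have pt : p.+1%:R^-1 < t / 2.
    have t2 : 0 < t / 2 by rewrite divr_gt0.
    have := truncnS_gt (t / 2)^-1; rewrite -/p => lt.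
    by rewrite invf_plt ?posrE ?ltr0n.
  apply: (@lt_le_trans _ _ (mu (lim_sup_set (fun k => [set x | t < g k x]%R)))).
    apply: limsup_superlevel_gt0 mA Afin t0 _ hg Fc.
    by rewrite aE -EFinM lte_fin /t -mulrA -[X in _ < X]mulr1 ltr_pM2l // mulrC ltr_pdivrMr; lra.
  apply: le_measure; rewrite ?inE //.
    apply: bigcapT_measurable => n; apply: bigcup_measurable => k _.
    exact: measurable_superlevel.
  move=> x H; exists p => // n _; have [k nk /= gk] := H n I; exists k => //=.
  by move: pt gk; move: (p.+1%:R^-1 : R) => e; lra.
Qed.

End TailHull.

(** * Ergodic measures *)

(** Continuity from above: the sets where [f] exceeds an integer decrease to the empty set inside
    [A]. *)
Lemma measure_tail_small d (T : measurableType d) (R : realType)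
    (mu : {measure set T -> \bar R}) (A : set T) (f : T -> R) (e : R) :
  measurable A -> (mu A < +oo)%E -> measurable_fun [set: T] f -> 0 < e ->
  exists2 K : R, 0 <= K & (mu (A `&` [set x | K < f x]%R) <= e%:E)%E.
Proof.
move=> mA Afin mf e0.
pose B (k : nat) := A `&` [set x | k%:R < f x]%R.
have mB k : measurable (B k) by apply: measurableI => //; apply: measurable_superlevel.
have B0 : \bigcap_k B k = set0.
  apply/seteqP; split=> // x H.
  have [_ /=] := H (Num.truncn (f x)).+1 I.
  by rewrite ltNge (ltW (truncnS_gt _)).
have : (mu \o B) k @[k --> \oo] --> mu (\bigcap_k B k).
  apply: nonincreasing_cvg_mu => //.
  - apply: le_lt_trans Afin; apply: le_measure; rewrite ?inE //.
    by move=> x [].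
  - by rewrite B0.
  - move=> i j ij; apply/subsetPset => x [Ax /= jx]; split=> //=.
    by apply: le_lt_trans jx; rewrite ler_nat.
rewrite B0 measure0 => cv.
apply: contrapT => no; suff : (e%:E <= 0)%E by rewrite lee_fin leNgt e0.
rewrite -(cvg_lim _ cv) //; apply: lime_ge; first by apply/cvg_ex; eexists; exact: cv.
apply: nearW => k; rewrite leNgt; apply/negP => lt; apply: no.
by exists k%:R => //; apply/ltW.
Qed.

(** * Averages of indicator functions *)

Section AverageIndic.
Context d (T : measurableType d) (R : realType) (mu : {measure set T -> \bar R}).
Variables (N : nat) (S : 'I_N.+1 -> set T) (D : set T).
Hypotheses (mS : forall i, measurable (S i)) (mD : measurable D).

(** Such averages bracket the averaged cutoff from both sides, reducing its integrals to measures of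
    translated sets. *)
Definition average_indic (x : T) : R := N.+1%:R^-1 * \sum_i \1_(S i) x.

Lemma measurable_average_indic : measurable_fun [set: T] average_indic.
Proof.
apply: measurable_funM; first exact: measurable_cst.
by apply: measurable_sum => i; apply: measurable_indic.
Qed.

Lemma average_indic_ge0 x : 0 <= average_indic x.
Proof. by rewrite mulr_ge0 // sumr_ge0 // => i _; rewrite indicE. Qed.

Lemma integral_average_indic :
  (\int[mu]_(x in D) (average_indic x)%:E = N.+1%:R^-1%:E * \sum_i mu (S i `&` D))%E.
Proof.
under eq_integral do rewrite EFinM -sumEFin.
rewrite ge0_integralZl_EFin //.
- rewrite ge0_integral_sum //.
  + by congr (_ * _)%E; apply: eq_bigr => i _; rewrite integral_indic.
  + by move=> i; apply/measurable_EFinP; apply: measurable_indic.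
- by move=> x _; apply: sume_ge0 => i _; rewrite lee_fin.
- by apply: emeasurable_sum => i; apply/measurable_EFinP; apply: measurable_indic.
Qed.

Lemma integral_average_indic_le (M : R) : (forall i, mu (S i `&` D) <= M%:E)%E ->
  (\int[mu]_(x in D) (average_indic x)%:E <= M%:E)%E.
Proof.
move=> SM; rewrite integral_average_indic.
apply: (@le_trans _ _ (N.+1%:R^-1%:E * \sum_(i < N.+1) M%:E)%E).
  by rewrite lee_pmul2l // ?lte_fin ?invr_gt0 // lee_sum.
by rewrite sumEFin -EFinM sumr_const card_ord -[M *+ _]mulr_natl mulKf.
Qed.

Lemma integral_average_indic_ge (c : R) : (forall i, c%:E <= mu (S i `&` D))%E ->
  (c%:E <= \int[mu]_(x in D) (average_indic x)%:E)%E.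
Proof.
move=> Sc; rewrite integral_average_indic.
apply: (@le_trans _ _ (N.+1%:R^-1%:E * \sum_(i < N.+1) c%:E)%E); last first.
  by rewrite lee_pmul2l // ?lte_fin ?invr_gt0 // lee_sum.
by rewrite sumEFin -EFinM sumr_const card_ord -[c *+ _]mulr_natl mulKf.
Qed.

End AverageIndic.

(** * A 1-Lipschitz cutoff *)

Section Cutoff.
Variables (R : realType) (r : R).

(** A ramp in place of an indicator, because matched net points agree only approximately. *)
Definition cutoff (x : R) : R := Num.max 0 (Num.min 1 (r + 1 - x)).

Lemma cutoffP x : [\/ x <= r /\ cutoff x = 1,
  r < x <= r + 1 /\ cutoff x = r + 1 - x | r + 1 < x /\ cutoff x = 0].
Proof.
rewrite /cutoff; have [xr|rx] := leP x r.
  by constructor 1; split=> //; rewrite min_l ?max_r ?ler01 //; lra.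
rewrite min_r; last by lra.
have [xr|rx1] := leP x (r + 1).
  by constructor 2; split=> //; rewrite max_r //; lra.
by constructor 3; split=> //; rewrite max_l //; lra.
Qed.

Lemma cutoff01 x : 0 <= cutoff x <= 1.
Proof. by case: (cutoffP x) => -[? ->]; apply/andP; split; lra. Qed.

Lemma cutoff_lipschitz x y : `|cutoff x - cutoff y| <= `|x - y|.
Proof.
rewrite ler_norml; have := ler_norm (x - y); have := ler_norm (y - x).
rewrite [`|y - x|]distrC.
by case: (cutoffP x) => -[? ->]; case: (cutoffP y) => -[? ->] => *; apply/andP;
  split; lra.
Qed.

Lemma cutoff_ge x : (x <= r)%R%:R <= cutoff x.
Proof.
have [xr|rx] := leP x r; last by case/andP: (cutoff01 x).
by case: (cutoffP x) => -[? ->]; rewrite //=; lra.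
Qed.

Lemma cutoff_le x : cutoff x <= (x <= r + 1)%R%:R.
Proof.
have [xr|rx] := leP x (r + 1); first by case/andP: (cutoff01 x).
by case: (cutoffP x) => -[? ->]; rewrite //=; lra.
Qed.

End Cutoff.

(** * Almost invariant functions and finiteness of the measure *)

Section Main.
Variable R : realType.
Local Notation C := R[i].
Local Notation H := (infherm R).
Implicit Types (u v : Uinf R) (h : infherm R).

Lemma frob2_corner_act n u h : Uinf_level n u ->
  frob2 (corner_mx n (Uinf_act u h)) = frob2 (corner_mx n h).
Proof.
move=> L; rewrite corner_mx_act //; have U : corner_mx n u \is unitarymx by case: L.
by rewrite frob2_mulr_unitary ?trmxC_unitary // frob2_mull_unitary.
Qed.

Lemma eq_corner_norm m n h h' : (m <= n)%N -> corner_mx n h = corner_mx n h' ->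
  corner_norm m h = corner_norm m h'.
Proof.
move=> mn E; apply: eq_bigr => i _; apply: eq_bigr => j _; congr normc.
have := congr1 (fun M : 'M[C]_n => M (widen_ord mn i) (widen_ord mn j)) E.
by rewrite !mxE.
Qed.

(** The m-corner is seen at a common level of [u] and [v], where the finite corners can be
    multiplied and embedded back. *)
Lemma Uinf_act_comp m u v : exists w, forall h,
  corner_norm m (Uinf_act u (Uinf_act v h)) = corner_norm m (Uinf_act w h).
Proof.
have [n1 L1] := Uinf_level_exists u; have [n2 L2] := Uinf_level_exists v.
pose n := (n1 + n2 + m)%N.
have {}L1 : Uinf_level n u by apply: Uinf_level_leq L1; rewrite /n; lia.
have {}L2 : Uinf_level n v by apply: Uinf_level_leq L2; rewrite /n; lia.
have [w Lw wE] : exists2 w : Uinf R, Uinf_level n w &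
    corner_mx n w = corner_mx n u *m corner_mx n v.
  by apply: Uinf_embed; apply: mul_unitarymx; [case: L1|case: L2].
exists w => h; apply: (@eq_corner_norm _ n); first by rewrite /n leq_addl.
by rewrite (corner_mx_act _ L1) (corner_mx_act _ L2) (corner_mx_act _ Lw) wE trmx_mul map_mxM !mulmxA.
Qed.

Lemma conj_entry_close n (X Y M : 'M[C]_n) (eps k : R) a b :
  X \is unitarymx -> Y \is unitarymx -> 0 <= eps -> 0 <= k ->
  (forall i j, normc (X i j - Y i j) <= eps) -> (forall i j, normc (M i j) <= k) ->
  normc ((X *m M *m X^t*) a b - (Y *m M *m Y^t*) a b) <= n%:R * (n%:R * (2 * k * eps)).
Proof.
move=> XU YU e0 k0 XY Mk; rewrite !mxE -sumrB.
apply: le_trans (normc_sum _ _ _) _.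
apply: (@le_trans _ _ (\sum_(j < n) n%:R * (2 * k * eps))); last first.
  by rewrite sumr_const card_ord -[X in X <= _]mulr_natl.
apply: ler_sum => j _; rewrite !mxE !mulr_suml -sumrB.
apply: le_trans (normc_sum _ _ _) _.
apply: (@le_trans _ _ (\sum_(i < n) (2 * k * eps))); last first.
  by rewrite sumr_const card_ord -[X in X <= _]mulr_natl.
apply: ler_sum => i _.
have -> : X a i * M i j * (X b j)^*%R - Y a i * M i j * (Y b j)^*%R =
    (X a i - Y a i) * M i j * (X b j)^*%R + Y a i * M i j * (X b j - Y b j)^*%R.
  by rewrite rmorphB /=; ring.
apply: le_trans (le_normcD _ _) _.
have -> : 2 * k * eps = eps * k * 1 + 1 * k * eps by ring.
by apply: lerD; rewrite !normcM normc_conj !ler_pM ?mulr_ge0 ?normc_ge0 ?normc_unitary.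
Qed.

(** Translation by [u] turns the net into a permutation of itself up to [eps]. Entries of [h] are
    bounded by [Num.sqrt K], so conjugation by matched points moves the corner by at most [q * eps],
    and reindexing compares the sums term by term. *)
Lemma approx_invariant_average m n (phi : R -> R) (K dl : R) : (m <= n)%N ->
  (forall x y, `|phi x - phi y| <= `|x - y|) -> 0 < dl ->
  exists (N : nat) (E : 'I_N.+1 -> Uinf R), forall u h, Uinf_level n u ->
    frob2 (corner_mx n h) <= K ->
    `| \sum_i phi (corner_norm m (Uinf_act (E i) (Uinf_act u h))) -
       \sum_i phi (corner_norm m (Uinf_act (E i) h)) | <= N.+1%:R * dl.
Proof.
move=> mn phi1 dl0; pose k := Num.sqrt K; have k0 : 0 <= k by apply: sqrtr_ge0.
pose q := n%:R * (n%:R * (2 * k)).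
have q0 : 0 <= q by rewrite !mulr_ge0.
pose eps := dl / (q + 1); have eps0 : 0 < eps by rewrite divr_gt0 //; lra.
have qeps : q * eps <= dl.
  by rewrite /eps mulrA ler_pdivrMr; [nra|lra].
have [N [e [eU enet]]] := unitary_net_balanced n eps0.
have /choice[E HE] i : exists v : Uinf R, Uinf_level n v /\ corner_mx n v = e i.
  by have [v Lv vE] := Uinf_embed (eU i); exists v.
exists N, E => u h Lu hK.
have uU : corner_mx n u \is unitarymx by case: Lu.
have [s sinj sclose] := enet _ uU.
rewrite [X in _ - X](reindex_inj sinj) /= -sumrB.
apply: le_trans (ler_norm_sum _ _ _) _.
apply: (@le_trans _ _ (\sum_(i < N.+1) dl));
  last by rewrite sumr_const card_ord -[X in X <= _]mulr_natl.
apply: ler_sum => i _; apply: le_trans (phi1 _ _) _.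
apply: corner_norm_lipschitz => [|a b am bm]; first exact: ltW.
have an := leq_trans am mn; have bn := leq_trans bm mn.
have [Li Ei] := HE i; have [Ls Es] := HE (s i).
have -> : Uinf_act (E i) (Uinf_act u h) a b =
  (e i *m corner_mx n u *m corner_mx n h *m (e i *m corner_mx n u)^t*) (Ordinal an) (Ordinal bn).
  rewrite trmx_mul map_mxM !mulmxA -Ei.
  have <- : corner_mx n (Uinf_act (E i) (Uinf_act u h)) (Ordinal an) (Ordinal bn) =
    Uinf_act (E i) (Uinf_act u h) a b by rewrite mxE.
  by rewrite (corner_mx_act _ Li) (corner_mx_act _ Lu) !mulmxA.
have -> : Uinf_act (E (s i)) h a b =
  (e (s i) *m corner_mx n h *m (e (s i))^t*) (Ordinal an) (Ordinal bn).
  by rewrite -Es -corner_mx_act // mxE.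
apply: le_trans qeps; rewrite /q -!mulrA [2 * _]mulrA.
apply: (conj_entry_close _ _ _ (eU (s i)) (ltW eps0) k0 (sclose i)).
  exact: (mul_unitarymx (eU i) uU).
move=> c d; rewrite /k -[X in X <= _]ger0_norm ?normc_ge0 // -sqrtr_sqr ler_wsqrtr //.
exact: le_trans (sqr_normc_frob2 _ _ _) hK.
Qed.

Variables (m : nat) (nu : {measure set H -> \bar R}).
Hypotheses (nuF : classF m nu) (nu_inv : Uinf_invariant_measure nu).

Lemma measurable_corner_le n r : measurable [set h : H | corner_norm n h <= r].
Proof.
rewrite (_ : [set h | _] = ~` [set h | r < corner_norm n h]).
  by apply: measurableC; apply: measurable_superlevel; apply: measurable_corner_norm.
by apply/seteqP; split=> h /=; rewrite leNgt => /negP.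
Qed.

Lemma measurable_corner_act_le n u r :
  measurable [set h : H | corner_norm n (Uinf_act u h) <= r].
Proof.
rewrite (_ : [set h | _] = ~` [set h | r < corner_norm n (Uinf_act u h)]).
  by apply: measurableC; apply: measurable_superlevel;
    apply: measurable_corner_norm_act.
by apply/seteqP; split=> h /=; rewrite leNgt => /negP.
Qed.

Lemma corner_act_tight : nu setT != 0%E ->
  exists r r' c : R, [/\ 0 < r, 0 <= r', 0 < c & forall u,
    (c%:E <= nu ([set h | corner_norm m h <= r]%R `&`
                 [set h | corner_norm m (Uinf_act u h) <= r']%R))%E].
Proof.
(* The 2m-corner is what [Uinf_reduce] controls. These sets exhaust [H], so one has positive
   measure; it is finite because the m-corner is bounded on it. *)
move=> nu0; pose A (k : nat) := [set h : H | corner_norm (m + m) h <= k.+1%:R].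
have mA k : measurable (A k) by apply: measurable_corner_le.
have [k Ak] : exists k, nu (A k) != 0%E.
  apply: contrapT => nA; case/negP: nu0; apply/eqP.
  have AT : [set: H] `<=` \bigcup_k A k.
    move=> h _; exists (Num.truncn (corner_norm (m + m) h)) => //=.
    exact/ltW/truncnS_gt.
  apply/eqP; rewrite eq_le measure_ge0 andbT.
  apply: (@le_trans _ _ (\sum_(0 <= k <oo) nu (A k))%E).
    exact: measure_sigma_subadditive.
  rewrite eseries0 // => j _ _; apply/eqP; apply: contrapT => /negP Aj.
  by apply: nA; exists j.
have rgt : 0 < k.+1%:R :> R by rewrite ltr0n.
have Afin : (nu (A k) < +oo)%E.
  apply: le_lt_trans (nuF rgt); apply: le_measure; rewrite ?inE //.
    exact: measurable_corner_le.
  by move=> h /=; apply: le_trans; apply: corner_norm_leq; rewrite leq_addr.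
have AE : nu (A k) = (fine (nu (A k)))%:E by rewrite fineK // ge0_fin_numE.
exists k.+1%:R, (((m + m) ^ 2)%:R * k.+1%:R), (fine (nu (A k))).
split=> //.
  by rewrite -lte_fin -AE lt_neqAle eq_sym Ak measure_ge0.
move=> u; rewrite -AE; have [v [v1 v2]] := Uinf_reduce m u.
set B := _ `&` _; have mB : measurable B.
  by apply: measurableI; [exact: measurable_corner_le|exact: measurable_corner_act_le].
(* By invariance [B] may be pulled back along [v], and this preimage contains [A k] whatever [u]
   is. *)
rewrite -(nu_inv v mB); apply: le_measure; rewrite ?inE //.
  rewrite (_ : _ @^-1` _ = [set h | corner_norm m (Uinf_act v h) <= k.+1%:R] `&`
     [set h | corner_norm m (Uinf_act u (Uinf_act v h)) <= ((m + m) ^ 2)%:R * k.+1%:R]); last by [].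
  apply: measurableI; first exact: measurable_corner_act_le.
  have [w wE] := Uinf_act_comp m u v.
  rewrite (_ : [set h | _] = [set h : H | corner_norm m (Uinf_act w h) <= ((m + m) ^ 2)%:R * k.+1%:R]).
    exact: measurable_corner_act_le.
  by apply/seteqP; split=> h /=; rewrite wE.
move=> h /= Ah; split=> /=.
  by rewrite v1; apply: le_trans Ah; apply: corner_norm_leq; rewrite leq_addr.
by apply: le_trans (v2 h) _; rewrite ler_wpM2l.
Qed.

Lemma approx_invariant_cutoff (r r' c dl : R) n : (m <= n)%N ->
  0 < r -> 0 <= r' -> 0 < c -> 0 < dl ->
  (forall u, (c%:E <= nu ([set h | corner_norm m h <= r]%R `&`
     [set h | corner_norm m (Uinf_act u h) <= r']%R))%E) ->
  exists F : H -> R, [/\ measurable_fun [set: H] F, forall h, 0 <= F h <= 1,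
    (\int[nu]_h (F h)%:E <= nu [set h | corner_norm m h <= r' + 1]%R)%E,
    ((c / 2)%:E <= \int[nu]_(h in [set h | corner_norm m h <= r]%R) (F h)%:E)%E &
    forall u h, Uinf_level n u -> `|F (Uinf_act u h) - F h| <= dl].
Proof.
move=> mn r0 r'0 c0 dl0 tight; set A := [set h | corner_norm m h <= r]%R in tight *.
have mA : measurable A by apply: measurable_corner_le.
have Afin : (nu A < +oo)%E by apply: nuF.
have r1 : 0 < r' + 1 by lra.
set B := [set h | _ <= r' + 1]%R.
have BE : nu B = (fine (nu B))%:E.
  by rewrite fineK // ge0_fin_numE //; apply: nuF.
have mf := @measurable_frob2_corner R n.
have c2 : 0 < c / 2 by rewrite divr_gt0.
(* Truncating at Frobenius level [K] costs at most half of the mass [c] on [A]. *)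
have [K K0 HK] := measure_tail_small mA Afin mf c2.
pose psi := cutoff r'.
have [N [E HE]] := @approx_invariant_average m n psi K dl mn (@cutoff_lipschitz R r') dl0.
pose S := [set h : H | frob2 (corner_mx n h) <= K].
have SE : ~` S = [set h : H | K < frob2 (corner_mx n h)].
  by apply/seteqP; split=> h /=; rewrite ltNge => /negP.
have mSC : measurable (~` S) by rewrite SE; apply: measurable_superlevel.
have mS : measurable S by rewrite -(setCK S); apply: measurableC.
pose avg h := N.+1%:R^-1 * \sum_(i < N.+1) psi (corner_norm m (Uinf_act (E i) h)).
have mpsi : measurable_fun [set: R] psi.
  apply: measurable_maxr; first exact: measurable_cst.
  apply: measurable_minr; first exact: measurable_cst.
  by apply: measurable_funB; [exact: measurable_cst|exact: measurable_id].
have mavg : measurable_fun [set: H] avg.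
  apply: measurable_funM; first exact: measurable_cst.
  apply: measurable_sum => i; apply: (measurableT_comp mpsi).
  exact: measurable_corner_norm_act.
have avg_ge0 h : 0 <= avg h.
  by rewrite mulr_ge0 // sumr_ge0 // => i _;
    case/andP: (cutoff01 r' (corner_norm m (Uinf_act (E i) h))).
have avg_le1 h : avg h <= 1.
  rewrite /avg ler_pdivrMl // mulr1.
  apply: (@le_trans _ _ (\sum_(i < N.+1) 1)); last by rewrite sumr_const card_ord.
  by apply: ler_sum => i _; case/andP: (cutoff01 r' (corner_norm m (Uinf_act (E i) h))).
pose F h := \1_S h * avg h.
have mF : measurable_fun [set: H] F by apply: measurable_funM.
have F01 h : 0 <= F h <= 1.
  rewrite /F indicE; have := avg_ge0 h; have := avg_le1 h.
  by case: (_ \in _) => a1 a0; rewrite ?mul0r ?mul1r ?a0 ?a1 ?lexx ?ler01.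
have indS h : \1_S h = (frob2 (corner_mx n h) <= K)%R%:R :> R.
  by rewrite indicE mem_setE.
pose Sr t (i : 'I_N.+1) := [set h : H | corner_norm m (Uinf_act (E i) h) <= t].
have mSr t i : measurable (Sr t i) by apply: measurable_corner_act_le.
have indSr t i h : \1_(Sr t i) h = (corner_norm m (Uinf_act (E i) h) <= t)%R%:R :> R.
  by rewrite indicE mem_setE.
exists F; split=> //.
- rewrite BE;
  apply: (@le_trans _ _ (\int[nu]_h (average_indic R (Sr (r' + 1)) h)%:E)%E).
    apply: ge0_le_integral => //.
    + by move=> h _; rewrite lee_fin; case/andP: (F01 h).
    + exact/measurable_EFinP.
    + by apply/measurable_EFinP; apply: measurable_average_indic.
    + move=> h _; rewrite lee_fin; apply: (@le_trans _ _ (avg h)).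
        by rewrite /F indicE; case: (_ \in _); rewrite ?mul0r ?mul1r.
      rewrite /avg /average_indic ler_wpM2l //.
      by apply: ler_sum => i _; rewrite indSr; apply: cutoff_le.
  apply: integral_average_indic_le => // i; rewrite setIT -BE.
  by rewrite -(nu_inv (E i) (measurable_corner_le m (r' + 1))).
(* On [A] the average of the indicators is at most [avg], which is at most [F] on [S] and at most 1
   off [S]. *)
- have : (c%:E <= \int[nu]_(h in A) (F h)%:E + \int[nu]_(h in A) (\1_(~` S) h)%:E)%E.
    have mF' : measurable_fun A (fun h => (F h)%:E).
      by apply/measurable_EFinP; apply: measurable_funS mF.
    have mI : measurable_fun A (fun h => (\1_(~` S) h)%:E : \bar R).
      by apply/measurable_EFinP; apply: measurable_indic.
    have F0 h : A h -> (0 <= (F h)%:E)%E by move=> _; rewrite lee_fin;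
      case/andP: (F01 h).
    rewrite -ge0_integralD //.
    apply: (@le_trans _ _ (\int[nu]_(h in A) (average_indic R (Sr r') h)%:E)%E).
      apply: integral_average_indic_ge => // i; rewrite setIC; exact: tight.
    apply: ge0_le_integral => //.
    + by move=> h _; rewrite lee_fin; apply: average_indic_ge0.
    + by apply/measurable_EFinP; apply: (measurable_funS measurableT) => //;
      apply: measurable_average_indic.
    + exact: emeasurable_funD.
    + move=> h _; rewrite -EFinD lee_fin.
      have le : average_indic R (Sr r') h <= avg h.
        rewrite /avg /average_indic ler_wpM2l //.
        by apply: ler_sum => i _; rewrite indSr; apply: cutoff_ge.
      rewrite /F !indicE in_setC; case: (_ \in _); first by rewrite mul1r addr0.
      by rewrite mul0r add0r; apply: le_trans le _.
  rewrite integral_indic // setIC SE => le.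
  have {le} : (c%:E <= \int[nu]_(h in A) (F h)%:E + (c / 2)%:E)%E.
    by apply: le_trans le _; rewrite leeD2l.
  rewrite -leeBlDr // -EFinB; apply: le_trans; rewrite lee_fin; lra.
(* Unitary conjugation preserves the Frobenius norm, so [h] and its image lie both inside or both
   outside the truncation set. *)
- move=> u h Lu; rewrite /F !indS frob2_corner_act //.
  have [hK|hK] := leP (frob2 (corner_mx n h)) K;
    last by rewrite !mul0r subrr normr0 ltW.
  rewrite !mul1r /avg -mulrBr normrM ger0_norm // ler_pdivrMl //.
  exact: HE.
Qed.

Hypothesis nu_erg : Uinf_ergodic nu.

Lemma ergodic_classF_finite : (nu [set: H] < +oo)%E.
Proof.
have [->|nu0] := eqVneq (nu setT) 0%E; first by rewrite ltry.
have [r [r' [c [r0 r'0 c0 tight]]]] := corner_act_tight nu0.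
have dl0 n : 0 < n.+1%:R^-1 :> R by rewrite invr_gt0.
(* Level [n + m] meets the requirement that the level be at least [m]; the defect [n.+1%:R^-1] tends
   to 0. *)
have /choice[F HF] n := approx_invariant_cutoff (leq_addl n m) r0 r'0 c0 (dl0 n) tight.
set A := [set h | corner_norm m h <= r]%R in HF.
have mA : measurable A by apply: measurable_corner_le.
have Afin : (nu A < +oo)%E by apply: nuF.
have r1 : 0 < r' + 1 by lra.
have BE : nu [set h | corner_norm m h <= r' + 1]%R =
    (fine (nu [set h | corner_norm m h <= r' + 1]%R))%:E.
  by rewrite fineK // ge0_fin_numE //; apply: nuF.
have c2 : 0 < c / 2 by rewrite divr_gt0.
have F_meas n : measurable_fun [set: H] (F n) by case: (HF n).
have F01 n h : 0 <= F n h <= 1 by case: (HF n).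
have F_int n : (\int[nu]_h (F n h)%:E <=
    (fine (nu [set h | corner_norm m h <= r' + 1]%R))%:E)%E.
  by rewrite -BE; case: (HF n).
have F_A n : ((c / 2)%:E <= \int[nu]_(h in A) (F n h)%:E)%E by case: (HF n).
have [g [s [hg]]] := tail_hull_limsup F_meas F01 F_int mA Afin c2 F_A.
set Z := \bigcup_p _ => -[mZ Zfin Z0].
have g_near k u h : Uinf_level k u -> `|g k (Uinf_act u h) - g k h| <= k.+1%:R^-1.
  move=> Lu; elim: (hg k) => [n kn|f f' _ IH _ IH'].
    have [_ _ _ _ /(_ u h)] := HF n.
    move=> /(_ (Uinf_level_leq (leq_trans kn (leq_addr m n)) Lu)) /le_trans; apply.
    by rewrite lef_pV2 ?posrE ?ltr0n // ler_nat.
  move: IH IH'; move: (k.+1%:R^-1 : R) => e.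
  by rewrite /= !ler_norml => /andP[? ?] /andP[? ?]; apply/andP; split; lra.
have Zsub u h : Z h -> Z (Uinf_act u h).
  (* The margin [p.+1%:R^-1] is twice [(2 * p).+2%:R^-1]: the action of [u] on a late [g k] consumes
     at most one half, and the other half remains as the margin of index [(2 * p).+1]. Hence [Z] is
     invariant exactly, not only up to null sets. *)
  move=> [p _ Hp]; exists (2 * p).+1 => // n _.
  have [q Lq] := Uinf_level_exists u.
  have [k /= nk gk] := Hp (n + q + (2 * p).+1)%N I.
  have [kn kq k2p] : [/\ (n <= k)%N, (q <= k)%N & ((2 * p).+1 <= k)%N].
    by clear -nk; split; lia.
  exists k => //=.
  have := g_near k u h (Uinf_level_leq kq Lq); rewrite ler_norml => /andP[gu _].
  have kp : k.+1%:R^-1 <= (2 * p).+2%:R^-1 :> R.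
    by rewrite lef_pV2 ?posrE ?ltr0n // ler_nat ltnS.
  have p2 : p.+1%:R^-1 = 2 * (2 * p).+2%:R^-1 :> R.
    by rewrite -[(2 * p).+2]/(2 + 2 * p)%N -mulnS natrM invfM mulrA divff // mul1r.
  move: gk; rewrite p2; move: kp gu.
  move: (k.+1%:R^-1 : R) ((2 * p).+2%:R^-1 : R) (g k h) (g k (Uinf_act u h)) => x y z w.
  by clear; lra.
have Zinv : Uinf_invariant_set Z.
  move=> u; apply/seteqP; split=> [_ [h Zh <-]|h Zh]; first exact: Zsub.
  by exists (Uinf_act (Uinf_inv u) h); [exact: Zsub|exact: Uinf_actVK].
have [Z_0|ZC0] := nu_erg mZ Zinv; first by rewrite Z_0 ltxx in Z0.
rewrite -(setUv Z); apply: le_lt_trans (measureU2 nu mZ (measurableC mZ)) _.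
apply: lte_add_pinfty => //; apply: (@le_lt_trans _ _ 0%E); last exact: ltry.
by rewrite le_eqVlt; apply/orP; left; apply/eqP; exact: ZC0.
Qed.

End Main.

Theorem theorem2 (R : realType) (m : nat)
    (nu : {measure set (infherm R) -> \bar R})
    (nuF : classF m nu)
    (nu_inv : Uinf_invariant_measure nu)
    (nu_erg : Uinf_ergodic nu) :
  (nu [set: infherm R] < +oo)%E.
Proof. exact: ergodic_classF_finite nuF nu_inv nu_erg. Qed.
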